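(* Let $n\ge2$ and let $\mathbf{T}=(T_1,\dots,T_n)$ be a $\mathbf{\Theta}_n$-contraction on a Hilbert space $\mathcal H$. Let $E_1,\dots,E_{n-1}\in\mathcal B(\mathcal D_{T_n^p})$ be the fundamental operators of the $\Gamma_n$-contraction $(T_1,\dots,T_{n-1},T_n^p)$. If $\mathbf{T}$ admits a $\mathbf{\Theta}_n$-isometric dilation, then the following conditions hold. (1) The $(n-1)$-tuple $(\gamma_1E_1,\dots,\gamma_{n-1}E_{n-1})$ admits a joint dilation to a commuting $(n-1)$-tuple of subnormal operators $(\gamma_1\widetilde{T}_1,\dots,\gamma_{n-1}\widetilde{T}_{n-1})$; that is, there exist a Hilbert space $\mathcal K$, an isometry $\Lambda:\mathcal D_{T_n^p}\to\mathcal K$ and commuting operators $\widetilde T_1,\dots,\widetilde T_{n-1}$ on $\mathcal K$ such that $E_i=\Lambda^*\widetilde{T}_i\Lambda$ for $1\le i\le n-1$, and $(\gamma_1\widetilde{T}_1,\dots,\gamma_{n-1}\widetilde{T}_{n-1})$ extends to a commuting $(n-1)$-tuple of normal operators $(\gamma_1U_1,\dots,\gamma_{n-1}U_{n-1})$ whose joint spectrum is contained in $\Gamma_{n-1}$. (2) For every $1\le i,j\le n-1$, $\bigl(E_{n-i}^*D_{T_n^p}T_j-E_{n-j}^*D_{T_n^p}T_i\bigr)\big|_{\ker D_{T_n^p}}=0$. (3) For every $1\le i,j\le n-1$, $\bigl(E_i^*E_j^*-E_j^*E_i^*\bigr)D_{T_n^p}T_n^p\big|_{\ker D_{T_n^p}}=0$.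 (4) The objects $\mathcal K,\Lambda,\widetilde T_1,\ldots,\widetilde T_{n-1}$ in (1) can be chosen so that, in addition, there exists an isometry $\Lambda_*:\mathcal D_{T_n}\to\mathcal K$ such that for every $1\le i\le n-1$, $$\bigl(\widetilde{T}_{n-i}^*\Lambda D_{T_n^p}T_n-\Lambda_*D_{T_n}T_i\bigr)\Big|_{\ker D_{T_n}\cap\ker D_{T_n^p}}=0 .$$
   Context: Fix integers $m,p\ge 1$ with $p\mid m$ and put $q=m/p$. $\mathbb D$ is the open unit disc and $\mathbb T$ the unit circle in $\mathbb C$. For $d\ge1$ and $z\in\mathbb C^d$ let $s_i(z)=\sum_{1\le k_1<\cdots<k_i\le d}z_{k_1}\cdots z_{k_i}$, $\mathbf s=(s_1,\ldots,s_d)$ and $\Gamma_d=\mathbf s(\overline{\mathbb D}^{\,d})$. Define $\theta=(\theta_1,\ldots,\theta_n)$ on $\mathbb C^n$ by $\theta_i(z)=s_i(z_1^m,\ldots,z_n^m)$ for $1\le i\le n-1$ and $\theta_n(z)=(z_1\cdots z_n)^q$; put $\mathbf{\Theta}_n=\theta(\mathbb D^n)$, $\overline{\mathbf{\Theta}}_n=\theta(\overline{\mathbb D}^{\,n})$; the distinguished (Shilov) boundary is $b\mathbf{\Theta}_n=\theta(\mathbb T^n)$. Put $\gamma_i=\frac{n-i}{n}$ for $1\le i\le n-1$. A compact set $\Omega\subset\mathbb C^d$ is a spectral set for a commuting $d$-tuple $\mathbf T$ if the (Taylor) joint spectrum satisfies $\sigma(\mathbf T)\subseteq\Omega$ and $\|f(\mathbf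 T)\|\le\sup_\Omega|f|$ for every $f$ holomorphic on a neighbourhood of $\Omega$. A $\mathbf{\Theta}_n$-contraction (respectively, $\Gamma_d$-contraction) is a commuting tuple of bounded operators having $\overline{\mathbf{\Theta}}_n$ (respectively, $\Gamma_d$) as a spectral set. If $(T_1,\ldots,T_n)$ is a $\mathbf{\Theta}_n$-contraction then $(T_1,\ldots,T_{n-1},T_n^p)$ is a $\Gamma_n$-contraction. A $\mathbf{\Theta}_n$-unitary is a commuting $n$-tuple of bounded normal operators with joint spectrum in $b\mathbf{\Theta}_n$; a $\mathbf{\Theta}_n$-isometry is the restriction of a $\mathbf{\Theta}_n$-unitary to a joint invariant subspace. A $\mathbf{\Theta}_n$-isometric dilation of a $\mathbf{\Theta}_n$-contraction $\mathbf T$ on $\mathcal H$ is a $\mathbf{\Theta}_n$-isometry $\mathbf V$ on a Hilbert space containing $\mathcal H$ such that $V_i^*|_{\mathcal H}=T_i^*$ for $1\le i\le n$. For a contraction $T$, $D_T=(I-T^*T)^{1/2}$ and $\mathcal D_T=\overline{\operatorname{Ran}}\,D_T$. The fundamental operators of a $\Gamma_n$-contraction $(S_1,\ldots,S_n)$ are the (existing and unique) operators $E_1,\ldots,E_{n-1}\in\mathcal B(\mathcal D_{S_n})$ with $S_i-S_{n-i}^*S_n=D_{S_n}E_iD_{S_n}$ for $1\le i\le n-1$. A tuple $(A_1,\ldots,A_d)$ on $\mathcal K$ extends to $(B_1,\ldots,B_d)$ on a Hilbert space $\mathcal L\supseteq\mathcal K$ if $\mathcal K$ is invariant for each $B_i$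 and $A_i=B_i|_{\mathcal K}$. *)

(* Defs.v *)
From HB Require Import structures.
From mathcomp Require Import all_boot all_order all_algebra complex.
From mathcomp Require Import all_classical all_reals all_analysis.

Set Implicit Arguments.
Unset Strict Implicit.
Unset Printing Implicit Defensive.

Import Order.TTheory GRing.Theory Num.Theory.
Import numFieldNormedType.Exports.

Local Open Scope classical_set_scope.
Local Open Scope ring_scope.
Local Open Scope complex_scope.

(* The topology of R[i], and through it that of 'rV[R[i]]_d, is the one of the
   norm, as mathcomp-analysis does for abstract numFieldTypes. *)
#[warning="-redundant-canonical-projection"]
HB.instance Definition _ (R : realType) := NormedModule.copy R[i] R[i]^o.

(* The inner product is linear in its first argument. *)
HB.mixin Record CompleteNormedModule_isHilbert (R : realType) (H : Type)
    & CompleteNormedModule R[i] H := {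
  inner : {dot H for (@Num.conj R[i])} ;
  inner_norm : forall x : H, inner x x = `|x| ^+ 2
}.

#[short(type="hilbertType")]
HB.structure Definition Hilbert (R : realType) :=
  {H of CompleteNormedModule R[i] H & CompleteNormedModule_isHilbert R H}.

Record bounded_op (R : realType) (H K : hilbertType R) := BoundedOp {
  bop_fun :> {linear H -> K} ;
  bop_continuous : continuous bop_fun
}.

Lemma bop0_continuous (R : realType) (H K : hilbertType R) :
  continuous (\0 : {linear H -> K}).
Proof. by move=> x; exact: cvg_cst. Qed.

Definition bop0 (R : realType) (H K : hilbertType R) : bounded_op H K :=
  BoundedOp (@bop0_continuous R H K).

Lemma bop_id_continuous (R : realType) (H : hilbertType R) :
  continuous (idfun : {linear H -> H}).
Proof. by move=> x; exact: cvg_id. Qed.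

Definition bop_id (R : realType) (H : hilbertType R) : bounded_op H H :=
  BoundedOp (@bop_id_continuous R H).

Lemma bop_comp_continuous (R : realType) (H K L : hilbertType R)
    (S : bounded_op K L) (T : bounded_op H K) :
  continuous (S \o T : {linear H -> L}).
Proof.
by move=> x; apply: continuous_comp; [exact: bop_continuous|exact: bop_continuous].
Qed.

Definition bop_comp (R : realType) (H K L : hilbertType R)
    (S : bounded_op K L) (T : bounded_op H K) : bounded_op H L :=
  BoundedOp (@bop_comp_continuous R H K L S T).

Definition bop_exp (R : realType) (H : hilbertType R) (T : bounded_op H H)
    (n : nat) : bounded_op H H :=
  iter n (bop_comp T) (bop_id H).

Lemma bop_scale_continuous (R : realType) (H K : hilbertType R) (c : R[i])
    (T : bounded_op H K) :
  continuous (c \*: T : {linear H -> K}).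
Proof. by move=> x; apply: cvgZl_tmp; exact: bop_continuous. Qed.

Definition bop_scale (R : realType) (H K : hilbertType R) (c : R[i])
    (T : bounded_op H K) : bounded_op H K :=
  BoundedOp (@bop_scale_continuous R H K c T).

HB.instance Definition _ (R : realType) (H K : hilbertType R) :=
  gen_eqMixin (bounded_op H K).
HB.instance Definition _ (R : realType) (H K : hilbertType R) :=
  gen_choiceMixin (bounded_op H K).
HB.instance Definition _ (R : realType) (H K : hilbertType R) :=
  isPointed.Build (bounded_op H K) (bop0 H K).

(* The adjoint exists and is unique by the Riesz representation theorem, so
   that the default value of [get] plays no role. *)
Definition adjoint (R : realType) (H K : hilbertType R) (T : bounded_op H K) :
    bounded_op K H :=
  get [set S : bounded_op K H | forall x y, inner (T x) y = inner x (S y)].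

Definition isometric (R : realType) (H K : hilbertType R)
    (J : bounded_op H K) : Prop :=
  forall x, `|J x| = `|x|.

Definition normal_op (R : realType) (H : hilbertType R)
    (T : bounded_op H H) : Prop :=
  forall x, adjoint T (T x) = T (adjoint T x).

Definition commuting (R : realType) (H : hilbertType R) (d : nat)
    (T : 'I_d -> bounded_op H H) : Prop :=
  forall i j x, T i (T j x) = T j (T i x).

(* [D] is D_T = (I - T^* T)^(1/2), characterized as the unique positive operator
   with square I - T^* T; it exists if and only if [T] is a contraction. *)
Definition is_defect_op (R : realType) (H : hilbertType R)
    (T D : bounded_op H H) : Prop :=
  (forall x, 0 <= inner (D x) x) /\
  (forall x, D (D x) = x - adjoint T (T x)).

Record closed_subspace (R : realType) (H : hilbertType R) := ClosedSubspace {
  cs_set : set H ;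
  cs_closed : closed cs_set ;
  cs_0 : cs_set 0 ;
  cs_linear : forall (a : R[i]) x y, cs_set x -> cs_set y -> cs_set (a *: x + y)
}.

Definition cs_pred (R : realType) (H : hilbertType R) (V : closed_subspace H) :
  {pred H} := mem (cs_set V).

Lemma cs_submod_closed (R : realType) (H : hilbertType R)
  (V : closed_subspace H) : submod_closed (cs_pred V).
Proof.
split; first by rewrite inE; exact: cs_0.
by move=> a x y; rewrite !inE; exact: cs_linear.
Qed.

HB.instance Definition _ (R : realType) (H : hilbertType R)
  (V : closed_subspace H) :=
  GRing.isSubmodClosed.Build R[i] H (cs_pred V) (cs_submod_closed V).

Record cs_type (R : realType) (H : hilbertType R) (V : closed_subspace H) :=
  CsElt { cs_val : H ; cs_valP : cs_val \in cs_pred V }.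
Arguments CsElt {R H V}.
Arguments cs_val {R H V}.

HB.instance Definition _ (R : realType) (H : hilbertType R)
  (V : closed_subspace H) := [isSub for @cs_val R H V].
HB.instance Definition _ (R : realType) (H : hilbertType R)
  (V : closed_subspace H) := [Choice of cs_type V by <:].
HB.instance Definition _ (R : realType) (H : hilbertType R)
  (V : closed_subspace H) := [SubChoice_isSubLmodule of cs_type V by <:].

Lemma cs_normD (R : realType) (H : hilbertType R) (V : closed_subspace H)
  (x y : cs_type V) : `|val (x + y)| <= `|val x| + `|val y| :> R[i].
Proof. by rewrite raddfD ler_normD. Qed.

Lemma cs_normZ (R : realType) (H : hilbertType R) (V : closed_subspace H)
  (a : R[i]) (x : cs_type V) : `|val (a *: x)| = `|a| * `|val x| :> R[i].
Proof. by rewrite linearZ normrZ. Qed.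

Lemma cs_norm0_eq0 (R : realType) (H : hilbertType R) (V : closed_subspace H)
  (x : cs_type V) : `|val x| = 0 :> R[i] -> x = 0.
Proof. by move/normr0_eq0 => x0; apply: val_inj; rewrite raddf0. Qed.

HB.instance Definition _ (R : realType) (H : hilbertType R)
  (V : closed_subspace H) :=
  Lmodule_isNormed.Build R[i] (cs_type V) (@cs_normD R H V) (@cs_normZ R H V)
    (@cs_norm0_eq0 R H V).

Lemma cs_complete (R : realType) (H : hilbertType R) (V : closed_subspace H)
  (F : set_system (cs_type V)) : ProperFilter F -> cauchy F -> cvg F.
Proof.
move=> FF Fc.
have Gc : cauchy (val @ F : set_system H).
  apply/cauchy_ballP => e e0.
  have /cauchy_ballP /(_ e e0) [[A B] /= [FA FB] AB] := Fc.
  exists (val @` A, val @` B).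
    by split; [apply: filterS FA|apply: filterS FB] => x ?; exists x.
  move=> [_ _] /= [[x Ax <-] [y By <-]].
  have := AB (x, y) (conj Ax By).
  by rewrite -!ball_normE /ball_ /= -[cs_val x - _](raddfB val).
have /cvg_ex [/= h hG] : cvg (val @ F : set_system H) by exact: cauchy_cvg.
have Vh : h \in cs_pred V.
  rewrite inE; apply: (closed_cvg (cs_set V) (@cs_closed _ _ V) _ _ hG).
  by apply: nearW => x; have := valP x; rewrite inE.
apply/cvg_ex; exists (CsElt h Vh); apply/cvgrPdist_lt => e e0.
have /cvgrPdist_lt /(_ e e0) := hG.
by apply: filterS => x; rewrite -[h]/(val (CsElt h Vh)) -raddfB.
Qed.

HB.instance Definition _ (R : realType) (H : hilbertType R)
  (V : closed_subspace H) :=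
  Uniform_isComplete.Build (cs_type V) (@cs_complete R H V).

Definition cs_inner (R : realType) (H : hilbertType R) (V : closed_subspace H)
  (x y : cs_type V) : R[i] := inner (val x) (val y).

Lemma cs_inner_linearl (R : realType) (H : hilbertType R)
  (V : closed_subspace H) (y : cs_type V) :
  GRing.linear_for *%R (@cs_inner R H V ^~ y).
Proof. by move=> a x x'; rewrite /cs_inner linearP linearPl. Qed.

Lemma cs_inner_linearr (R : realType) (H : hilbertType R)
  (V : closed_subspace H) (x : cs_type V) :
  GRing.linear_for (@Num.conj R[i] \; *%R) (@cs_inner R H V x).
Proof. by move=> a y y'; rewrite /cs_inner (linearP val) linearPr. Qed.

HB.instance Definition _ (R : realType) (H : hilbertType R)
  (V : closed_subspace H) :=
  bilinear_isBilinear.Build R[i] (cs_type V) (cs_type V) R[i] *%R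
    (@Num.conj R[i] \; *%R) (@cs_inner R H V)
    (@cs_inner_linearl R H V, @cs_inner_linearr R H V).

Lemma cs_inner_hermitian (R : realType) (H : hilbertType R)
  (V : closed_subspace H) (x y : cs_type V) :
  cs_inner x y = (-1) ^+ false * Num.conj (cs_inner y x).
Proof. exact: hermitian_subproof. Qed.

HB.instance Definition _ (R : realType) (H : hilbertType R)
  (V : closed_subspace H) :=
  isHermitianSesquilinear.Build R[i] (cs_type V) false (@Num.conj R[i])
    (@cs_inner R H V) (@cs_inner_hermitian R H V).

Lemma cs_inner_gt0 (R : realType) (H : hilbertType R)
  (V : closed_subspace H) (x : cs_type V) : x != 0 -> 0 < cs_inner x x.
Proof.
move=> x0; rewrite /cs_inner inner_norm exprn_gt0// normr_gt0.
by apply: contra_neq x0 => vx0; apply: val_inj; rewrite vx0 raddf0.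
Qed.

HB.instance Definition _ (R : realType) (H : hilbertType R)
  (V : closed_subspace H) :=
  isDotProduct.Build R[i] (cs_type V) (@cs_inner R H V) (@cs_inner_gt0 R H V).

Lemma cs_inner_norm (R : realType) (H : hilbertType R)
  (V : closed_subspace H) (x : cs_type V) :
  (@cs_inner R H V : {dot cs_type V for Num.conj}) x x = `|x| ^+ 2.
Proof. exact: inner_norm. Qed.

HB.instance Definition _ (R : realType) (H : hilbertType R)
  (V : closed_subspace H) :=
  CompleteNormedModule_isHilbert.Build R (cs_type V) (@cs_inner_norm R H V).

Lemma closure_range_linear (R : realType) (H K : hilbertType R)
    (D : bounded_op H K) (a : R[i]) (x y : K) :
  closure (range D) x -> closure (range D) y -> closure (range D) (a *: x + y).
Proof.
move=> Dx Dy B Bxy.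
have f_cont : (fun u : K * K => a *: u.1 + u.2) u @[u --> (x, y)] --> a *: x + y.
  by apply: cvgD; [apply: cvgZl_tmp; exact: cvg_fst|exact: cvg_snd].
have [[U V] /= [Ux Vy] UV] := f_cont B Bxy.
have [_ [[u _ <-] Du]] := Dx U Ux.
have [_ [[v _ <-] Dv]] := Dy V Vy.
exists (a *: D u + D v); split; last exact: (UV (D u, D v)).
by exists (a *: u + v) => //; rewrite linearP.
Qed.

Lemma closure_range0 (R : realType) (H K : hilbertType R) (D : bounded_op H K) :
  closure (range D) 0.
Proof. by apply: subset_closure; exists 0; rewrite ?linear0. Qed.

Definition ran_closure (R : realType) (H K : hilbertType R)
    (D : bounded_op H K) : closed_subspace K :=
  ClosedSubspace (@closed_closure _ (range D)) (closure_range0 D)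
    (@closure_range_linear R H K D).

Definition defect_space (R : realType) (H : hilbertType R)
    (D : bounded_op H H) : hilbertType R :=
  cs_type (ran_closure D).

Lemma corestrict_subproof (R : realType) (H : hilbertType R)
  (D : bounded_op H H) (x : H) : D x \in cs_pred (ran_closure D).
Proof. by rewrite inE; apply: subset_closure; exists x. Qed.

Definition corestrict (R : realType) (H : hilbertType R)
    (D : bounded_op H H) (x : H) : defect_space D :=
  CsElt (D x) (corestrict_subproof D x).

(* The Koszul complex of T - z acts on H (x) Lambda(e_0, ..., e_(d-1)); an
   element of this space is represented by its coefficients x S with respect to
   the e_(i_1) /\ ... /\ e_(i_k), S = {i_1 < ... < i_k}, and the differential is
   the sum of the e_i /\ _ (x) (T_i - z_i). *)
Definition koszul (R : realType) (H : hilbertType R) (d : nat)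
    (T : 'I_d -> bounded_op H H) (z : 'rV[R[i]]_d) (x : {set 'I_d} -> H)
    (S : {set 'I_d}) : H :=
  \sum_(i in S) (-1) ^+ #|[set j in S | (j < i)%N]| *:
     (T i (x (S :\ i)%SET) - z 0 i *: x (S :\ i)%SET).

(* The differential is homogeneous of degree 1, so that the exactness of the
   Koszul complex in every degree amounts to ker = im on the whole space. *)
Definition koszul_exact (R : realType) (H : hilbertType R) (d : nat)
    (T : 'I_d -> bounded_op H H) (z : 'rV[R[i]]_d) : Prop :=
  forall x, (forall S, koszul T z x S = 0) ->
    exists y, forall S, x S = koszul T z y S.

Definition joint_spectrum (R : realType) (H : hilbertType R) (d : nat)
    (T : 'I_d -> bounded_op H H) : set 'rV[R[i]]_d :=
  [set z | ~ koszul_exact T z].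

Definition holomorphic_on (R : realType) (d : nat) (U : set 'rV[R[i]]_d)
    (f : 'rV[R[i]]_d -> R[i]) : Prop :=
  open U /\ forall z, U z -> differentiable f z.

Definition holomorphic_near (R : realType) (d : nat) (A : set 'rV[R[i]]_d)
    (f : 'rV[R[i]]_d -> R[i]) : Prop :=
  exists2 U, A `<=` U & holomorphic_on U f.

(* Every commuting tuple [T] has exactly one functional calculus f |-> f(T) with
   the following properties: the existence, with the spectral mapping theorem,
   is due to Taylor, the uniqueness to Putinar.  Holomorphic germs on the joint
   spectrum are represented by total functions, whose values away from the
   spectrum are irrelevant by [calculus_germ]. *)
Record is_taylor_calculus (R : realType) (H : hilbertType R) (d : nat)
    (T : 'I_d -> bounded_op H H)
    (Phi : ('rV[R[i]]_d -> R[i]) -> bounded_op H H) : Prop := TaylorCalculus {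
  calculus_germ : forall U f g, joint_spectrum T `<=` U ->
    holomorphic_on U f -> (forall z, U z -> f z = g z) -> Phi f =1 Phi g ;
  calculus_one : forall x, Phi (fun=> 1) x = x ;
  calculus_coord : forall i, Phi (fun z => z 0 i) =1 T i ;
  calculus_add : forall f g,
    holomorphic_near (joint_spectrum T) f ->
    holomorphic_near (joint_spectrum T) g ->
    forall x, Phi (fun z => f z + g z) x = Phi f x + Phi g x ;
  calculus_scale : forall (c : R[i]) f,
    holomorphic_near (joint_spectrum T) f ->
    forall x, Phi (fun z => c * f z) x = c *: Phi f x ;
  calculus_mul : forall f g,
    holomorphic_near (joint_spectrum T) f ->
    holomorphic_near (joint_spectrum T) g ->
    forall x, Phi (fun z => f z * g z) x = Phi f (Phi g x) ;
  calculus_continuous : forall U (f_ : nat -> 'rV[R[i]]_d -> R[i]) f,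
    joint_spectrum T `<=` U ->
    (forall k, holomorphic_on U (f_ k)) -> holomorphic_on U f ->
    (forall K, compact K -> K `<=` U -> {uniform K, f_ @ \oo --> f}) ->
    forall e : R, 0 < e ->
      \forall k \near \oo, forall x, `|Phi (f_ k) x - Phi f x| <= e%:C * `|x| ;
  calculus_spectral_mapping : forall r (f : 'I_r -> 'rV[R[i]]_d -> R[i]),
    (forall j, holomorphic_near (joint_spectrum T) (f j)) ->
    joint_spectrum (fun j => Phi (f j)) =
    (fun z => \row_j f j z) @` joint_spectrum T
}.

Definition sup_norm (R : realType) (d : nat) (Omega : set 'rV[R[i]]_d)
    (f : 'rV[R[i]]_d -> R[i]) : R :=
  sup [set complex.Re `|f z| | z in Omega].

Definition spectral_set (R : realType) (H : hilbertType R) (d : nat)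
    (Omega : set 'rV[R[i]]_d) (T : 'I_d -> bounded_op H H) : Prop :=
  [/\ compact Omega, commuting T, joint_spectrum T `<=` Omega
    & exists2 Phi, is_taylor_calculus T Phi &
        forall f, holomorphic_near Omega f ->
          forall x, `|Phi f x| <= (sup_norm Omega f)%:C * `|x| ].

Definition closed_polydisc (R : realType) (d : nat) : set 'rV[R[i]]_d :=
  [set z | forall i, `|z 0 i| <= 1].
Arguments closed_polydisc : clear implicits.

Definition torus (R : realType) (d : nat) : set 'rV[R[i]]_d :=
  [set z | forall i, `|z 0 i| = 1].
Arguments torus : clear implicits.

Definition elem_sym (R : realType) (d i : nat) (z : 'rV[R[i]]_d) : R[i] :=
  \sum_(A : {set 'I_d} | #|A| == i) \prod_(k in A) z 0 k.

(* In the row vectors below, the entry of index i is the (i+1)-st coordinate. *)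
Definition symmetrization (R : realType) (d : nat) (z : 'rV[R[i]]_d) :
    'rV[R[i]]_d :=
  \row_(i < d) elem_sym i.+1 z.

Definition Gamma (R : realType) (d : nat) : set 'rV[R[i]]_d :=
  @symmetrization R d @` closed_polydisc R d.
Arguments Gamma : clear implicits.

Definition theta (R : realType) (m p n : nat) (z : 'rV[R[i]]_n) :
    'rV[R[i]]_n :=
  \row_(i < n) if i.+1 == n then (\prod_j z 0 j) ^+ (m %/ p)
               else elem_sym i.+1 (\row_j z 0 j ^+ m).

Definition Theta_closed (R : realType) (m p n : nat) : set 'rV[R[i]]_n :=
  @theta R m p n @` closed_polydisc R n.
Arguments Theta_closed : clear implicits.

Definition bTheta (R : realType) (m p n : nat) : set 'rV[R[i]]_n :=
  @theta R m p n @` torus R n.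
Arguments bTheta : clear implicits.

Definition Theta_contraction (R : realType) (H : hilbertType R) (m p n : nat)
    (T : 'I_n -> bounded_op H H) : Prop :=
  spectral_set (Theta_closed R m p n) T.

Definition Theta_unitary (R : realType) (H : hilbertType R) (m p n : nat)
    (U : 'I_n -> bounded_op H H) : Prop :=
  [/\ commuting U, forall i, normal_op (U i)
    & joint_spectrum U `<=` bTheta R m p n].

(* [K] is identified with the closed subspace [J K] of [L], which is then
   invariant for each [B i]. *)
Definition extends_to (R : realType) (K L : hilbertType R) (d : nat)
    (A : 'I_d -> bounded_op K K) (J : bounded_op K L)
    (B : 'I_d -> bounded_op L L) : Prop :=
  isometric J /\ forall i x, B i (J x) = J (A i x).

Definition Theta_isometry (R : realType) (K : hilbertType R) (m p n : nat)
    (V : 'I_n -> bounded_op K K) : Prop :=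
  exists (L : hilbertType R) (J : bounded_op K L) (U : 'I_n -> bounded_op L L),
    Theta_unitary m p U /\ extends_to V J U.

Definition has_Theta_isometric_dilation (R : realType) (H : hilbertType R)
    (m p n : nat) (T : 'I_n -> bounded_op H H) : Prop :=
  exists (K : hilbertType R) (J : bounded_op H K) (V : 'I_n -> bounded_op K K),
    [/\ isometric J, Theta_isometry m p V
      & forall i h, adjoint (V i) (J h) = J (adjoint (T i) h) ].

(* From here on n = k.+1: an n-tuple is indexed by 'I_k.+1, an (n-1)-tuple by
   'I_k, and i : 'I_k stands for the mathematical index i+1 in {1, ..., n-1}.
   Then T_(i+1) is [T (low i)], T_n is [T ord_max], and the mathematical index
   n-(i+1) = (k-i-1)+1 is [rev_ord i]. *)
Definition low (k : nat) (i : 'I_k) : 'I_k.+1 := widen_ord (leqnSn k) i.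

Definition last_exp (R : realType) (H : hilbertType R) (p k : nat)
    (T : 'I_k.+1 -> bounded_op H H) (i : 'I_k.+1) : bounded_op H H :=
  if i == ord_max then bop_exp (T ord_max) p else T i.

(* S_i - S_(n-i)^* S_n = D E_i D, where D is the defect operator of S_n. *)
Definition fundamental_operators (R : realType) (H : hilbertType R) (k : nat)
    (S : 'I_k.+1 -> bounded_op H H) (D : bounded_op H H)
    (E : 'I_k -> bounded_op (defect_space D) (defect_space D)) : Prop :=
  forall i x,
    S (low i) x - adjoint (S (low (rev_ord i))) (S ord_max x) =
    D (val (E i (corestrict D x))).

(* gamma_(i+1) = (n-(i+1))/n with n = k.+1. *)
Definition gamma (R : realType) (k : nat) (i : 'I_k) : R[i] :=
  (k - i)%:R / k.+1%:R.

Definition gamma_scale (R : realType) (K : hilbertType R) (k : nat)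
    (T : 'I_k -> bounded_op K K) (i : 'I_k) : bounded_op K K :=
  bop_scale (gamma R i) (T i).

Definition subnormal_dilation (R : realType) (DD K : hilbertType R) (k : nat)
    (E : 'I_k -> bounded_op DD DD) (Lam : bounded_op DD K)
    (Tt : 'I_k -> bounded_op K K) : Prop :=
  [/\ isometric Lam,
      commuting Tt,
      forall i x, E i x = adjoint Lam (Tt i (Lam x))
    & exists (L : hilbertType R) (J : bounded_op K L)
             (U : 'I_k -> bounded_op L L),
        [/\ commuting (gamma_scale U),
            forall i, normal_op (gamma_scale U i),
            joint_spectrum (gamma_scale U) `<=` Gamma R k
          & extends_to (gamma_scale Tt) J (gamma_scale U) ] ].

(* Main.v *)
Require Import Defs.
From HB Require Import structures.
From mathcomp Require Import all_boot all_order all_algebra complex.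
From mathcomp Require Import all_classical all_reals all_analysis.
From mathcomp Require Import ring lra zify.
From mathcomp Require cyclic separable cyclotomic.

Set Implicit Arguments.
Unset Strict Implicit.
Unset Printing Implicit Defensive.

Import Order.TTheory GRing.Theory Num.Theory.
Import numFieldNormedType.Exports.

Local Open Scope classical_set_scope.
Local Open Scope ring_scope.
Local Open Scope complex_scope.

(* A Theta_n-isometry V satisfies V_n^* V_n = 1 and V_i = V_(n-i)^* V_n^p.  If V
   dilates T through the isometry J, then V leaves ker J^* invariant, and with Q
   the projection onto ker J^* the map D_(T_n^p) h |-> Q V_n^p J h extends to an
   isometry Lambda that compresses V_i | ker J^* to E_i; for h in the kernel of
   D_(T_n^p) both V_n^p J h and V_i J h lie in the range of J, and conditions
   (2)-(4) follow.
   The relations come from the unitary extension U: by Fuglede's theorem U is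
   doubly commuting, so that a failure of one of them can be localized, by
   splitting off one self-adjoint part at a time, at a joint approximate
   eigenvalue of U.  Joint approximate eigenvalues belong to the Taylor spectrum,
   hence to bTheta, where the relations hold.  Conversely, contraction with
   N_i^* (sum_i N_i^* N_i)^-1 shows that the Taylor spectrum of a normal tuple
   consists of approximate eigenvalues; those of (gamma_i U_i)_(i < n) extend to
   U, and lie in Gamma_(n-1) by the theorem of Gauss and Lucas. *)

(** * The real structure of a Hilbert space *)

(** Positive real forms stand in for the joint spectral measure of a normal tuple. A form a is
    degenerate if it is arbitrarily small on unit vectors; those vectors play the part of a spectral
    subspace that may be zero. For a self-adjoint X, a real t has to be found such that a(x, x) + |X
    x - t x|^2 is still degenerate. It comes from an extremal problem: maximize <X x, x> under a
    penalty C a(x, x) with C growing. Commutation enters only through an inequality a(X x, X x) <= L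
    a(x, x), which the enlarged form inherits for the operators still to be treated. The initial
    form encodes what is to be localized: |s x - B^* B x|^2 for a relation B = 0 that fails, sum_i
    |V_i x - l_i x|^2 for a point l of the spectrum of V = (gamma_i U_i). As the final form
    dominates the initial one, that property is still visible at the point of the spectrum of U that
    is found. *)

Section ComplexModulus.
Context {R : realType}.

Definition cabs (c : R[i]) : R := complex.Re `|c|.

Lemma cabsE c : `|c| = (cabs c)%:C.
Proof. by rewrite /cabs RRe_real// normr_real. Qed.

Lemma cabs_ge0 c : 0 <= cabs c.
Proof. by rewrite /cabs normc_def/= sqrtr_ge0. Qed.

Lemma cabsM c d : cabs (c * d) = cabs c * cabs d.
Proof. by apply: complexI; rewrite rmorphM/= -!cabsE normrM. Qed.

Lemma cabsX c n : cabs (c ^+ n) = cabs c ^+ n.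
Proof. by apply: complexI; rewrite rmorphXn/= -!cabsE normrX. Qed.

Lemma cabsN c : cabs (- c) = cabs c.
Proof. by rewrite /cabs normrN. Qed.

Lemma cabsJ c : cabs c^* = cabs c.
Proof. by apply: complexI; rewrite -!cabsE norm_conjC. Qed.

Lemma cabsR (t : R) : cabs t%:C = `|t|.
Proof. by rewrite /cabs normc_def/= expr0n addr0 sqrtr_sqr. Qed.

Lemma cabs1 : cabs 1 = 1.
Proof. by rewrite /cabs normr1. Qed.

Lemma cabsi : cabs 'i = 1.
Proof. by rewrite /cabs normc_def/= expr0n expr1n add0r sqrtr1. Qed.

End ComplexModulus.

Section RealStructure.
Context {R : realType}.
Implicit Types (H K : hilbertType R).

(* All estimates are made with the real inner product Re <x, y>, which
   determines <x, y>. *)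
Definition rnorm H (x : H) : R := complex.Re `|x|.
Definition rinner H (x y : H) : R := complex.Re (inner x y).

Lemma normE H (x : H) : `|x| = (rnorm x)%:C.
Proof. by rewrite /rnorm RRe_real// normr_real. Qed.

Lemma rnorm_ge0 H (x : H) : 0 <= rnorm x.
Proof. by rewrite -lecR -normE normr_ge0. Qed.

Lemma rnormD H (x y : H) : rnorm (x + y) <= rnorm x + rnorm y.
Proof. by rewrite -lecR rmorphD/= -!normE ler_normD. Qed.

Lemma rnormN H (x : H) : rnorm (- x) = rnorm x.
Proof. by rewrite /rnorm normrN. Qed.

Lemma rnormB H (x y : H) : rnorm (x - y) <= rnorm x + rnorm y.
Proof. by rewrite (le_trans (rnormD _ _))// rnormN. Qed.

Lemma rnorm_distC H (x y : H) : rnorm (x - y) = rnorm (y - x).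
Proof. by rewrite -rnormN opprB. Qed.

Lemma rnorm0 H : rnorm (0 : H) = 0.
Proof. by rewrite /rnorm normr0. Qed.

Lemma rnorm0_eq0 H (x : H) : rnorm x = 0 -> x = 0.
Proof. by move=> x0; apply: normr0_eq0; rewrite normE x0. Qed.

Lemma rnormZ H (c : R[i]) (x : H) : rnorm (c *: x) = cabs c * rnorm x.
Proof. by apply: complexI; rewrite rmorphM/= -normE -cabsE -normE normrZ. Qed.

Lemma rnormZr H (t : R) (x : H) : rnorm (t%:C *: x) = `|t| * rnorm x.
Proof. by rewrite rnormZ cabsR. Qed.

Lemma innerC H (x y : H) : inner x y = (inner y x)^*.
Proof. by rewrite hermC expr0 mul1r. Qed.

Lemma rinnerC H (x y : H) : rinner x y = rinner y x.
Proof. by rewrite /rinner innerC; case: (inner y x). Qed.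

Lemma rinnerE H (x : H) : rinner x x = rnorm x ^+ 2.
Proof. by rewrite /rinner inner_norm normE -rmorphXn. Qed.

Lemma rinnerDl H (x y z : H) : rinner (x + y) z = rinner x z + rinner y z.
Proof. by rewrite /rinner linearDl raddfD. Qed.

Lemma rinnerZl H (t : R) (x z : H) : rinner (t%:C *: x) z = t * rinner x z.
Proof.
rewrite /rinner linearZl_LR /=; case: (inner x z) => a b.
by rewrite /= mul0r subr0.
Qed.

Lemma innerE H (x y : H) : inner x y = rinner x y +i* rinner x ('i *: y).
Proof.
rewrite /rinner linearZr_LR/=; case: (inner x y) => a b.
by rewrite /=; congr (_ +i* _); ring.
Qed.

End RealStructure.

(** * Positive semidefinite real forms and the Cauchy-Schwarz inequality *)

Section Forms.
Context {R : realType} {H : hilbertType R}.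
Implicit Types (a : H -> H -> R) (x y z : H).

(** Linearity over the reals is all that Cauchy-Schwarz needs, and real parts of sesquilinear forms
    have it. *)
Record psd_form a : Prop := PsdForm {
  psdDl : forall x y z, a (x + y) z = a x z + a y z ;
  psdZl : forall (t : R) x z, a (t%:C *: x) z = t * a x z ;
  psdC : forall x y, a x y = a y x ;
  psd_ge0 : forall x, 0 <= a x x
}.

Lemma psdDr a : psd_form a -> forall x y z, a z (x + y) = a z x + a z y.
Proof. by move=> ap x y z; rewrite psdC// psdDl// !(psdC ap z). Qed.

Lemma psdZr a : psd_form a -> forall (t : R) x z, a z (t%:C *: x) = t * a z x.
Proof. by move=> ap t x z; rewrite psdC// psdZl// !(psdC ap z). Qed.

Lemma psdNl a : psd_form a -> forall x z, a (- x) z = - a x z.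
Proof.
move=> ap x z; rewrite -mulN1r -(psdZl ap).
by rewrite (_ : (-1)%:C = -1 :> R[i]) ?scaleN1r// rmorphN1.
Qed.

Lemma psdNr a : psd_form a -> forall x z, a z (- x) = - a z x.
Proof. by move=> ap x z; rewrite psdC// psdNl// (psdC ap z). Qed.

Lemma psdE a x y (t : R) : psd_form a ->
  a (x + t%:C *: y) (x + t%:C *: y) = a x x + 2 * t * a x y + t ^+ 2 * a y y.
Proof.
move=> ap; rewrite psdDl// !psdDr// !psdZl// !psdZr// (psdC ap y x); ring.
Qed.

Lemma cauchy_schwarz a x y : psd_form a -> a x y ^+ 2 <= a x x * a y y.
Proof.
move=> ap; have P t : 0 <= a x x + 2 * t * a x y + t ^+ 2 * a y y.
  by rewrite -psdE// psd_ge0.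
have [y0|y0] := eqVneq (a y y) 0.
  have [->|xy0] := eqVneq (a x y) 0; first by rewrite y0 mulr0 expr0n.
  (* With a y y = 0 the polynomial in t is affine; this t gives it the value -1. *)
  have := P (- (a x x + 1) / (2 * a x y)); rewrite y0 mulr0 addr0.
  have -> : 2 * (- (a x x + 1) / (2 * a x y)) * a x y = - (a x x + 1) by field.
  lra.
have yp : 0 < a y y by rewrite lt_def y0 psd_ge0.
have := P (- a x y / a y y).
have -> : a x x + 2 * (- a x y / a y y) * a x y + (- a x y / a y y) ^+ 2 * a y y =
  a x x - a x y ^+ 2 / a y y by field.
by rewrite subr_ge0 ler_pdivrMr.
Qed.

Lemma psd_comp a (f : {linear H -> H}) : psd_form a ->
  psd_form (fun x y => a (f x) (f y)).
Proof.
move=> ap; split=> [x y z|t x z|x y|x]; rewrite ?linearD ?linearZ.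
- exact: psdDl.
- exact: psdZl.
- exact: psdC.
- exact: psd_ge0.
Qed.

Lemma psdD a b : psd_form a -> psd_form b ->
  psd_form (fun x y => a x y + b x y).
Proof.
move=> ap bp; split=> [x y z|t x z|x y|x].
- by rewrite !psdDl//; ring.
- by rewrite !psdZl//; ring.
- by rewrite (psdC ap) (psdC bp).
- by rewrite addr_ge0// psd_ge0.
Qed.

Lemma psd_sum (I : finType) (a : I -> H -> H -> R) :
  (forall i, psd_form (a i)) -> psd_form (fun x y => \sum_i a i x y).
Proof.
move=> ap; split=> [x y z|t x z|x y|x].
- by rewrite -big_split; apply: eq_bigr => i _; exact: psdDl.
- by rewrite mulr_sumr; apply: eq_bigr => i _; exact: psdZl.
- by apply: eq_bigr => i _; exact: psdC.
- by apply: sumr_ge0 => i _; exact: psd_ge0.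
Qed.

Lemma rinner_psd : psd_form (@rinner R H).
Proof.
split=> [x y z|t x z|x y|x].
- exact: rinnerDl.
- exact: rinnerZl.
- exact: rinnerC.
- by rewrite rinnerE sqr_ge0.
Qed.

Definition rinnerDr := psdDr rinner_psd.
Definition rinnerZr := psdZr rinner_psd.
Definition rinnerNl := psdNl rinner_psd.
Definition rinnerNr := psdNr rinner_psd.

Lemma rinnerBl x y z : rinner (x - y) z = rinner x z - rinner y z.
Proof. by rewrite rinnerDl rinnerNl. Qed.

Lemma rinnerBr x y z : rinner z (x - y) = rinner z x - rinner z y.
Proof. by rewrite rinnerDr rinnerNr. Qed.

Lemma rinner0l x : rinner 0 x = 0.
Proof. by rewrite -(subrr x) rinnerBl subrr. Qed.

Lemma rinner0r x : rinner x 0 = 0.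
Proof. by rewrite rinnerC rinner0l. Qed.

Lemma rinner_le x y : `|rinner x y| <= rnorm x * rnorm y.
Proof.
rewrite -ler_sqr ?nnegrE ?mulr_ge0 ?rnorm_ge0//.
by rewrite real_normK ?num_real// exprMn -!rinnerE cauchy_schwarz//; exact: rinner_psd.
Qed.

Lemma rinner_le1 x y : rinner x y <= rnorm x * rnorm y.
Proof. exact: le_trans (ler_norm _) (rinner_le x y). Qed.

Lemma rinner_inj x y : (forall z, rinner x z = rinner y z) -> x = y.
Proof.
move=> xy; apply/subr0_eq/rnorm0_eq0/eqP.
by rewrite -sqrf_eq0 -rinnerE rinnerBl xy subrr.
Qed.

Lemma rnormD2 x y :
  rnorm (x + y) ^+ 2 = rnorm x ^+ 2 + 2 * rinner x y + rnorm y ^+ 2.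
Proof. by rewrite -!rinnerE rinnerDl !rinnerDr (rinnerC y x); ring. Qed.

Lemma rnormB2 x y :
  rnorm (x - y) ^+ 2 = rnorm x ^+ 2 - 2 * rinner x y + rnorm y ^+ 2.
Proof. by rewrite rnormD2 rnormN rinnerNr; ring. Qed.

End Forms.

(** * Limits and closures in terms of real norms *)

Section Sequences.
Context {R : realType} {H : hilbertType R}.
Implicit Types (u : nat -> H) (l x y : H).

Definition seq_lim u l :=
  forall e : R, 0 < e -> exists N, forall n, (N <= n)%N -> rnorm (u n - l) < e.

Definition seq_cauchy u :=
  forall e : R, 0 < e -> exists N, forall m n, (N <= m)%N -> (N <= n)%N ->
    rnorm (u m - u n) < e.

Lemma seq_limP u l : seq_lim u l <-> u @ \oo --> l.
Proof.
split=> [ul|/cvgrPdist_lt ul e e0].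
  apply/cvgrPdist_lt => e e0.
  have er : e = (complex.Re e)%:C by rewrite RRe_real// gtr0_real.
  have [|N uN] := ul (complex.Re e); first by rewrite -ltcR -er.
  exists N => // n /= Nn; rewrite distrC normE er ltcR; exact: uN.
have [|N _ uN] := ul e%:C; first by rewrite ltcR.
by exists N => n Nn; have := uN n Nn; rewrite /= distrC normE ltcR.
Qed.

Lemma seq_cauchy_lim u : seq_cauchy u -> exists l, seq_lim u l.
Proof.
move=> uc.
have : cauchy (u @ \oo).
  apply/cauchy_ballP => e e0.
  have er : e = (complex.Re e)%:C by rewrite RRe_real// gtr0_real.
  have [|N uN] := uc (complex.Re e); first by rewrite -ltcR -er.
  exists (u @` [set n | (N <= n)%N], u @` [set n | (N <= n)%N]).
    by split; exists N => // n /= Nn; exists n.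
  move=> [_ _] /= [[m /= Nm <-] [n /= Nn <-]].
  by rewrite -ball_normE /ball_/= normE er ltcR; exact: uN.
by move/cauchy_cvg/cvg_ex => [l ul]; exists l; apply/seq_limP.
Qed.

Lemma closed_seq_lim (A : set H) u l :
  closed A -> (forall n, A (u n)) -> seq_lim u l -> A l.
Proof.
move=> cA Au /seq_limP ul; apply: (closed_cvg A cA _ _ ul).
exact: nearW.
Qed.

Lemma closureP (A : set H) y :
  closure A y <-> forall e : R, 0 < e -> exists2 x, A x & rnorm (x - y) < e.
Proof.
split=> [Ay e e0|Ay B /nbhs_ballP[e /= e0 yB]].
  have /Ay[x [Ax]] : nbhs y (ball y e%:C) by apply: nbhsx_ballx; rewrite ltcR.
  rewrite -ball_normE /ball_/= normE ltcR => xy; exists x => //.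
  by rewrite rnorm_distC.
have er : e = (complex.Re e)%:C by rewrite RRe_real// gtr0_real.
have [|x Ax xy] := Ay (complex.Re e); first by rewrite -ltcR -er.
exists x; split=> //; apply: yB.
by rewrite -ball_normE /ball_/= normE er ltcR rnorm_distC.
Qed.

Lemma seq_of_eps (P : R -> H -> Prop) :
  (forall e, 0 < e -> exists x, P e x) ->
  exists u, forall n, P n.+1%:R^-1 (u n).
Proof.
move=> Pe; have [|u uP] := @choice nat H (fun n x => P n.+1%:R^-1 x).
  by move=> n; apply: Pe; rewrite invr_gt0.
by exists u.
Qed.

Lemma inv_lt (e : R) : 0 < e -> exists N, forall n, (N <= n)%N -> n.+1%:R^-1 < e.
Proof.
move=> e0; exists (Num.truncn e^-1) => n Nn.
rewrite invf_plt ?posrE//; apply: lt_le_trans (truncnS_gt _) _.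
by rewrite ler_nat ltnS.
Qed.

End Sequences.

(** * Orthogonal projections and adjoints *)

Section Projection.
Context {R : realType} {H : hilbertType R}.
Implicit Types (V : closed_subspace H) (x y v : H).

Lemma csD V x y : cs_set V x -> cs_set V y -> cs_set V (x + y).
Proof. by move=> Vx Vy; rewrite -[x]scale1r; exact: cs_linear. Qed.

Lemma csZ V (c : R[i]) x : cs_set V x -> cs_set V (c *: x).
Proof. by move=> Vx; rewrite -[_ *: _]addr0; apply: cs_linear => //; exact: cs_0. Qed.

Lemma parallelogram x y :
  rnorm (x + y) ^+ 2 + rnorm (x - y) ^+ 2 = 2 * rnorm x ^+ 2 + 2 * rnorm y ^+ 2.
Proof. by rewrite rnormD2 rnormB2; ring. Qed.

Lemma quadratic_ge0 (b c : R) : 0 <= b ->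
  (forall t, 0 <= t ^+ 2 * b - 2 * t * c) -> c = 0.
Proof.
move=> b0 P; have [//|c0] := eqVneq c 0.
have b1 : b + 1 != 0 by lra.
(* The minimum is at t = c / b; the denominator b + 1 spares the case b = 0 and still gives a
   negative value. *)
have := P (c / (b + 1)).
have -> : (c / (b + 1)) ^+ 2 * b - 2 * (c / (b + 1)) * c =
  - (c / (b + 1)) ^+ 2 * (b + 2) by field.
have : 0 < (c / (b + 1)) ^+ 2 by rewrite exprn_even_gt0// mulf_neq0// invr_eq0.
nra.
Qed.

(** Serves to pass to the limit in squared distances: s is the distance to the limit point, a the
    distance to a term of the sequence, and the error 2 s b is linear in the distance b between the
    two. *)
Lemma sqr_le_perturb (s a b : R) : 0 <= s -> 0 <= a -> 0 <= b -> s <= a + b ->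
  s ^+ 2 <= a ^+ 2 + 2 * (s * b).
Proof.
move=> s0 a0 b0 sab; have [bs|sb] := lerP b s.
  have : (s - b) ^+ 2 <= a ^+ 2 by rewrite ler_sqr ?nnegrE; lra.
  have : 0 <= b ^+ 2 by rewrite sqr_ge0.
  by rewrite !expr2; lra.
have : 0 <= s * (b + b - s) by apply: mulr_ge0 => //; lra.
have : 0 <= a ^+ 2 by rewrite sqr_ge0.
by rewrite !expr2; lra.
Qed.

(** A minimizing sequence is Cauchy by the parallelogram law, as midpoints stay in V; its limit q
    minimizes the distance, and the variations q + t v give orthogonality. *)
Lemma orthogonal_projection V x :
  exists2 q, cs_set V q & forall v, cs_set V v -> rinner (x - q) v = 0.
Proof.
pose D := [set rnorm (x - v) ^+ 2 | v in cs_set V].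
have Dinf : has_inf D.
  split; first by exists (rnorm (x - 0) ^+ 2); exists 0 => //; exact: cs_0.
  by exists 0 => _ [v _ <-]; rewrite sqr_ge0.
pose d := inf D.
have dle v : cs_set V v -> d <= rnorm (x - v) ^+ 2.
  by move=> Vv; apply: ge_inf; [exact: Dinf.2|exists v].
have [u uP] : exists u : nat -> H, forall n, cs_set V (u n) /\
    rnorm (x - u n) ^+ 2 < d + n.+1%:R^-1.
  apply: (@seq_of_eps _ _ (fun e v => cs_set V v /\ rnorm (x - v) ^+ 2 < d + e)).
  by move=> e /(inf_adherent)/(_ Dinf) [_ [v Vv <-] ve]; exists v.
have uV n : cs_set V (u n) by case: (uP n).
have umn m n : rnorm (u m - u n) ^+ 2 <= 2 * (m.+1%:R^-1 + n.+1%:R^-1).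
  have := parallelogram (x - u n) (x - u m).
  have -> : x - u n - (x - u m) = u m - u n by rewrite opprB addrC subrKA.
  have -> : x - u n + (x - u m) = 2%:C *: (x - (2^-1)%:C *: (u n + u m)).
    rewrite scalerBr scalerA -rmorphM/= divff// scale1r.
    by rewrite rmorph_nat scaler_nat mulr2n opprD addrACA.
  rewrite rnormZr exprMn real_normK ?num_real//.
  have := dle ((2^-1)%:C *: (u n + u m)) (csZ _ (csD (uV _) (uV _))).
  have := (uP m).2; have := (uP n).2.
  set a := rnorm (x - _) ^+ 2; set b := rnorm (x - _) ^+ 2.
  set c := rnorm (x - _) ^+ 2; set e := rnorm _ ^+ 2.
  move: (m.+1%:R^-1) (n.+1%:R^-1) => i j; lra.
have [|q uq] := @seq_cauchy_lim _ _ u.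
  move=> e e0; have e4 : 0 < e ^+ 2 / 4 by rewrite divr_gt0// exprn_gt0.
  have [N NP] := inv_lt e4; exists N => m n Nm Nn.
  rewrite -ltr_sqr ?nnegrE ?rnorm_ge0 ?ltW//.
  apply: le_lt_trans (umn m n) _; have := NP _ Nm; have := NP _ Nn.
  by move: (m.+1%:R^-1) (n.+1%:R^-1) => i j; lra.
have Vq : cs_set V q by apply: closed_seq_lim uq => //; exact: cs_closed.
exists q => // v Vv.
have qd : rnorm (x - q) ^+ 2 <= d.
  apply/ler_addgt0Pr => e e0.
  pose s := rnorm (x - q).
  have s0 : 0 <= s by exact: rnorm_ge0.
  have [|N1 P1] := @inv_lt R (e / 2); first by rewrite divr_gt0.
  (* Makes the error 2 s b of [sqr_le_perturb] at most e / 2; s + 1 allows s = 0. *)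
  have [|N2 P2] := uq (e / (4 * (s + 1))); first by rewrite divr_gt0// mulr_gt0//; lra.
  pose n := maxn N1 N2.
  have := (uP n).2; have := P1 n (leq_maxl _ _); have := P2 n (leq_maxr _ _).
  rewrite ltr_pdivlMr ?mulr_gt0//; last by lra.
  have : s <= rnorm (x - u n) + rnorm (u n - q).
    by rewrite /s -[x - q](subrKA (u n)); exact: rnormD.
  have : 0 <= rnorm (u n - q) by exact: rnorm_ge0.
  have : 0 <= rnorm (x - u n) by exact: rnorm_ge0.
  rewrite -/s; move: (rnorm (x - u n)) (rnorm (u n - q)) => a b a0 b0 sab.
  move: (n.+1%:R^-1) => i h1 h2 h3; have := sqr_le_perturb s0 a0 b0 sab; lra.
apply: (@quadratic_ge0 (rnorm v ^+ 2)); first by rewrite sqr_ge0.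
move=> t.
have := dle (q + t%:C *: v) (csD Vq (csZ _ Vv)).
rewrite opprD addrA rnormB2 rinnerZr rnormZr exprMn real_normK ?num_real//.
by move: qd; lra.
Qed.

End Projection.

(** * Riesz representation, adjoints, and isometries on defect spaces *)

Section Operators.
Context {R : realType}.
Implicit Types (H K : hilbertType R).

Lemma bop_bounded H K (T : bounded_op H K) :
  exists2 M : R, 0 < M & forall x, rnorm (T x) <= M * rnorm x.
Proof.
have /linear_bounded_continuous /linear_boundedP/pinfty_ex_gt0[M M0 TM] :=
  @bop_continuous _ _ _ T.
have Mr : M = (complex.Re M)%:C by rewrite RRe_real// gtr0_real.
exists (complex.Re M); first by rewrite -ltcR -Mr.
by move=> x; have := TM x; rewrite !normE Mr -rmorphM lecR.
Qed.

Lemma bop_exists H K (f : H -> K) (M : R) :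
  (forall (a : R[i]) x y, f (a *: x + y) = a *: f x + f y) ->
  (forall x, rnorm (f x) <= M * rnorm x) ->
  exists T : bounded_op H K, forall x, T x = f x.
Proof.
move=> fl fM.
pose F : {linear H -> K} := HB.pack f (GRing.isLinear.Build _ _ _ _ f fl).
have Fc : continuous F.
  apply/bounded_linear_continuous/linear_boundedP.
  exists `|M|%:C; split; first by rewrite complex_real.
  move=> r; rewrite ltcE => /andP[/eqP/= r0 Mr] x.
  have -> : r = (complex.Re r)%:C by case: (r) r0 => a b /= ->.
  rewrite !normE -rmorphM lecR; apply: le_trans (fM x) _.
  rewrite ler_wpM2r ?rnorm_ge0//; apply: le_trans (ler_norm _) (ltW Mr).
by exists (BoundedOp Fc).
Qed.

Lemma rinnerJ H (x y : H) : rinner ('i *: x) ('i *: y) = rinner x y.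
Proof.
rewrite /rinner linearZl_LR linearZr_LR/=; case: (inner x y) => a b/=; ring.
Qed.

Lemma innerPr H (a : R[i]) (x y z : H) :
  inner z (a *: x + y) = a^* * inner z x + inner z y.
Proof. exact: linearPr. Qed.

Lemma innerPl H (a : R[i]) (x y z : H) :
  inner (a *: x + y) z = a * inner x z + inner y z.
Proof. exact: linearPl. Qed.

Lemma inner_inj H (x y : H) : (forall z, inner x z = inner y z) -> x = y.
Proof. by move=> xy; apply: rinner_inj => z; rewrite /rinner xy. Qed.

Lemma riesz H (f : H -> R[i]) (M : R) :
  (forall (a : R[i]) x y, f (a *: x + y) = a * f x + f y) ->
  (forall x, `|f x| <= (M * rnorm x)%:C) ->
  exists w, forall x, f x = inner x w.
Proof.
move=> fl fM.
have f0 : f 0 = 0 by have := fl 1 0 0; rewrite scale1r addr0 mul1r => /eqP; rewrite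
  addrC -subr_eq subrr eq_sym => /eqP.
have cl : closed [set x | f x = 0].
  move=> x /closureP xc /=; apply/eqP; rewrite -normr_eq0 eq_le normr_ge0 andbT.
  rewrite cabsE lecR; apply/ler_addgt0Pr => e e0; rewrite add0r.
  have M1 : 0 < `|M| + 1 by rewrite ltr_wpDl.
  have [|y /= fy yx] := xc (e / (`|M| + 1)); first by rewrite divr_gt0.
  rewrite ltr_pdivlMr// in yx.
  have -> : f x = f (x - y) by have := fl (-1) y x; rewrite fy mulr0 add0r scaleN1r
    addrC.
  rewrite -lecR -cabsE; apply: le_trans (fM (x - y)) _.
  rewrite lecR rnorm_distC; apply: le_trans (ltW yx).
  rewrite mulrC ler_wpM2l ?rnorm_ge0//; have := ler_norm M; lra.
have fL : forall (a : R[i]) x y, [set x | f x = 0] x -> [set x | f x = 0] y ->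
    [set x | f x = 0] (a *: x + y).
  by move=> a x y /= fx fy; rewrite fl fx fy mulr0 addr0.
pose V := ClosedSubspace cl f0 fL.
have [[x0 fx0]|] := pselect (exists x, f x != 0); last first.
  move=> nf; exists 0 => x; rewrite linear0r.
  by apply/eqP/negPn/negP => fx; apply: nf; exists x.
have [q /= fq qV] := orthogonal_projection V x0.
pose w := x0 - q.
have fw : f w = f x0 by have := fl (-1) q x0; rewrite fq mulr0 add0r scaleN1r addrC.
have Vw v : f v = 0 -> inner v w = 0.
  (* [qV] only concerns real parts; the imaginary part is its instance at 'i *: v, which is also in
     the kernel of f. *)
  move=> fv; rewrite innerC innerE -/w /= !qV//=; last first.
    by have := fl 'i v 0; rewrite addr0 f0 addr0 fv mulr0.
  by rewrite oppr0.
have w0 : inner w w != 0.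
  rewrite inner_norm sqrf_eq0 normr_eq0; apply: contra_neq fx0 => w0.
  by rewrite -fw w0.
exists (((f w) / inner w w)^* *: w) => x.
rewrite linearZr_LR/= conjCK.
(* A vector of the kernel, hence orthogonal to w; this is the representation formula. *)
have : f (f w *: x - f x *: w) = 0.
  have -> : f w *: x - f x *: w = (- f x) *: w + f w *: x by rewrite scaleNr addrC.
  rewrite fl; have := fl (f w) x 0; rewrite addr0 f0 addr0 => ->.
  by rewrite mulNr mulrC addNr.
move=> /Vw /eqP; rewrite linearBl !(linearZl_LR inner) subr_eq0 => /eqP fxw.
by apply: (mulIf w0); rewrite -fxw mulrAC divfK.
Qed.

Lemma adjoint_exists H K (T : bounded_op H K) :
  exists S : bounded_op K H, forall x y, inner (T x) y = inner x (S y).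
Proof.
have [M M0 TM] := bop_bounded T.
have [|S SP] := @choice K H (fun y w => forall x, inner (T x) y = inner x w).
  (* The 2 comes from adding the bounds of the real and imaginary parts of <T x, y>. *)
  move=> y; apply: (@riesz _ _ (2 * M * rnorm y)).
    by move=> a x x'; rewrite linearP linearPl.
  move=> x; rewrite innerE.
  apply: le_trans (_ : (`|rinner (T x) y| + `|rinner (T x) ('i *: y)|)%:C <= _).
    rewrite [X in `|X|]complexE/= rmorphD/=; apply: le_trans (ler_normD _ _) _.
    by rewrite normrM !cabsE cabsi mul1r !cabsR.
  rewrite lecR; have := rinner_le (T x) y; have := rinner_le (T x) ('i *: y).
  have -> : rnorm ('i *: y) = rnorm y.
    by rewrite rnormZ cabsi mul1r.
  have := ler_wpM2r (rnorm_ge0 y) (TM x); lra.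
have SR x y : rinner (T x) y = rinner x (S y) by rewrite /rinner SP.
have [||S' S'E] := @bop_exists _ _ S M.
- move=> a x y; apply: inner_inj => z.
  by rewrite innerC [RHS]innerC -(SP _ z) !innerPr -(SP x z) -(SP y z).
- move=> y; have [->|y0] := eqVneq (rnorm (S y)) 0.
    by rewrite mulr_ge0 ?rnorm_ge0// ltW.
  have yp : 0 < rnorm (S y) by rewrite lt_def y0 rnorm_ge0.
  rewrite -(ler_pM2l yp) -expr2 -rinnerE -SR.
  apply: le_trans (rinner_le1 _ _) _.
  by rewrite mulrA [_ * M]mulrC ler_wpM2r ?rnorm_ge0.
by exists S' => x y; rewrite S'E SP.
Qed.

Lemma adjointE H K (T : bounded_op H K) x y :
  inner (T x) y = inner x (adjoint T y).
Proof.
have [S SP] := adjoint_exists T.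
by have := @getPex _ [set S : bounded_op K H | forall x y, inner (T x) y = inner x
  (S y)]
  (ex_intro _ S SP); exact.
Qed.

Lemma radjE H K (T : bounded_op H K) x y :
  rinner (T x) y = rinner x (adjoint T y).
Proof. by rewrite /rinner adjointE. Qed.

Lemma radjEl H K (T : bounded_op H K) x y :
  rinner (adjoint T x) y = rinner x (T y).
Proof. by rewrite rinnerC -radjE rinnerC. Qed.

Lemma adjoint_unique H K (T : bounded_op H K) (S : K -> H) :
  (forall x y, rinner (T x) y = rinner x (S y)) -> adjoint T =1 S.
Proof.
by move=> TS y; apply: rinner_inj => x; rewrite rinnerC -radjE TS rinnerC.
Qed.

(** Positivity makes <D x, x> real; polarizing Im <D x, x> = 0 gives the symmetry. *)
Lemma positive_selfadjoint H (D : bounded_op H H) :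
  (forall x, 0 <= inner (D x) x) ->
  forall x y, rinner (D x) y = rinner x (D y).
Proof.
move=> D0.
have Dx x : rinner (D x) ('i *: x) = 0 by have /ger0_Im := D0 x; rewrite innerE.
have Dxy x y : rinner (D x) ('i *: y) = - rinner (D y) ('i *: x).
  have := Dx (x + y); rewrite linearD scalerDr rinnerDl !rinnerDr !Dx; lra.
move=> x y; have := Dxy x (- 'i *: y).
rewrite scalerA mulrN -expr2 sqr_i opprK scale1r => ->.
have -> : D (- 'i *: y) = - ('i *: D y) by rewrite scaleNr linearN linearZ.
by rewrite rinnerNl opprK rinnerJ rinnerC.
Qed.

Lemma isometry_extend H K (D : bounded_op H H) (W : H -> K) :
  (forall (a : R[i]) x y, W (a *: x + y) = a *: W x + W y) ->
  (forall x, rnorm (W x) = rnorm (D x)) ->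
  exists Lam : bounded_op (defect_space D) K,
    isometric Lam /\ forall x, Lam (corestrict D x) = W x.
Proof.
move=> Wl WD.
have WB x y : W (x - y) = W x - W y.
  by rewrite addrC -scaleN1r Wl scaleN1r addrC.
(* P is the closure of the graph {(D x, W x)}. It is shown to be the graph of a linear isometry on
   the closed range, so that nothing depends on the choice of approximating sequences. *)
pose P (y : defect_space D) z := forall e : R, 0 < e ->
  exists x, rnorm (D x - val y) < e /\ rnorm (W x - z) < e.
have Pex y : exists z, P y z.
  have yD : closure (range D) (val y) by have := valP y; rewrite inE.
  have [u uP] : exists u : nat -> H, forall n, rnorm (D (u n) - val y) < n.+1%:R^-1.
    apply: (@seq_of_eps _ _ (fun e x => rnorm (D x - val y) < e)) => e e0.
    by have /closureP/(_ e e0)[_ [x _ <-] xy] := yD; exists x.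
  have {uP} uP e : 0 < e -> exists N, forall n, (N <= n)%N -> rnorm (D (u n) - val
    y) < e.
    move=> /inv_lt[N NP]; exists N => n Nn; exact: lt_trans (uP n) (NP n Nn).
  have [|z uz] := @seq_cauchy_lim _ _ (W \o u).
    move=> e e0; have [|N NP] := uP (e / 2); first by rewrite divr_gt0.
    exists N => m n Nm Nn; rewrite /= -WB WD linearB.
    have := rnormB (D (u m) - val y) (D (u n) - val y).
    have -> : D (u m) - val y - (D (u n) - val y) = D (u m) - D (u n).
      by rewrite opprB addrA subrK.
    have := NP m Nm; have := NP n Nn; lra.
  exists z => e e0; have [N NP] := uP e e0; have [N' NP'] := uz e e0.
  exists (u (maxn N N')); split; first exact: NP (leq_maxl _ _).
  exact: NP' (leq_maxr _ _).
have Puniq y z z' : P y z -> P y z' -> z = z'.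
  move=> yz yz'; apply/subr0_eq/rnorm0_eq0/eqP; rewrite eq_le rnorm_ge0 andbT.
  apply/ler_addgt0Pr => e e0; rewrite add0r.
  have [|x [x1 x2]] := yz (e / 4); first by rewrite divr_gt0.
  have [|x' [x1' x2']] := yz' (e / 4); first by rewrite divr_gt0.
  have := WD (x - x'); rewrite WB linearB.
  have -> : z - z' = (W x - W x') - ((W x - z) - (W x' - z')).
    have -> : W x - z - (W x' - z') = W x - W x' - (z - z').
      by rewrite !opprD !opprK addrACA.
    by rewrite subKr.
  have := rnormB (W x - W x') ((W x - z) - (W x' - z')).
  have := rnormB (W x - z) (W x' - z').
  have := rnormB (D x - val y) (D x' - val y).
  have -> : D x - val y - (D x' - val y) = D x - D x'.
    by rewrite opprB addrA subrK.
  lra.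
have Plin a y y' z z' : P y z -> P y' z' -> P (a *: y + y') (a *: z + z').
  move=> yz yz' e e0; pose c := cabs a + 1.
  have c0 : 0 < c by rewrite ltr_wpDl// cabs_ge0.
  have [|x [x1 x2]] := yz (e / (2 * c)); first by rewrite divr_gt0// mulr_gt0.
  have [|x' [x1' x2']] := yz' (e / 2); first by rewrite divr_gt0.
  rewrite !ltr_pdivlMr ?mulr_gt0// in x1 x2.
  have H1 (G : hilbertType R) (u v u' v' : G) :
    rnorm (a *: u + v - (a *: u' + v')) <= (c - 1) * rnorm (u - u') + rnorm (v - v').
    rewrite opprD addrACA -scalerBr; apply: le_trans (rnormD _ _) _.
    by rewrite rnormZ /c addrK.
  exists (a *: x + x'); rewrite linearP Wl (linearP val); split.
    apply: le_lt_trans (H1 _ _ _ _ _) _.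
    have := rnorm_ge0 (D x - val y); move: x1; rewrite /= mulrA; nra.
  apply: le_lt_trans (H1 _ _ _ _ _) _.
  have := rnorm_ge0 (W x - z); move: x2; rewrite /= mulrA; nra.
have Pnorm y z : P y z -> rnorm z = rnorm y.
  move=> yz; apply/eqP; rewrite eq_le; apply/andP; split.
    apply/ler_addgt0Pr => e e0.
    have [|x [x1 x2]] := yz (e / 2); first by rewrite divr_gt0.
    have := rnormB (W x) (W x - z); rewrite opprB addrC subrK WD.
    have := rnormD (D x - val y) (val y); rewrite subrK -[rnorm (val y)]/(rnorm y); lra.
  apply/ler_addgt0Pr => e e0.
  have [|x [x1 x2]] := yz (e / 2); first by rewrite divr_gt0.
  have := rnormB (D x) (D x - val y); rewrite opprB addrC subrK -WD.
  have := rnormD (W x - z) z; rewrite subrK -[rnorm (val y)]/(rnorm y); lra.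
have [f fP] := @choice _ _ P Pex.
have [||Lam LamE] := @bop_exists _ _ f 1.
- by move=> a y y'; apply: (Puniq (a *: y + y')) => //; apply: Plin.
- by move=> y; rewrite mul1r (Pnorm _ _ (fP y)).
exists Lam; split=> [y|x]; first by rewrite !normE LamE (Pnorm _ _ (fP y)).
rewrite LamE; apply: (Puniq (corestrict D x)) => // e e0.
by exists x; rewrite !subrr !rnorm0.
Qed.

End Operators.

(** * Fuglede's theorem *)

Section RootsOfUnity.
Context {R : realType}.
Implicit Types (H K : hilbertType R).

Lemma rinnerZC H (c : R[i]) (x y : H) : rinner (c *: x) y = rinner x (c^* *: y).
Proof.
have := innerPl c x 0 y; have := innerPr c^* y 0 x.
by rewrite !addr0 conjCK /rinner => -> ->; rewrite (linear0l inner) (linear0r inner).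
Qed.

Lemma rnorm_sum H (I : Type) (r : seq I) (F : I -> H) :
  rnorm (\sum_(i <- r) F i) <= \sum_(i <- r) rnorm (F i).
Proof.
elim: r => [|i r IH]; first by rewrite !big_nil rnorm0.
by rewrite !big_cons; apply: le_trans (rnormD _ _) _; rewrite lerD2l.
Qed.

Lemma primitive_root_exists n : (0 < n)%N -> exists w : R[i], n.-primitive_root w.
Proof.
move=> n_gt0; pose p : {poly R[i]} := 'X^n - 1.
have [r Dp] := closed_field_poly_normal p.
rewrite (monicP _) ?monicXnsubC // scale1r in Dp.
have rn1 : all n.-unity_root r by apply/allP=> z; rewrite -root_prod_XsubC -Dp.
have sz_r : (n < (size r).+1)%N.
  by rewrite -(size_prod_XsubC r id) -Dp size_XnsubC.
have [|z] := hasP (cyclic.has_prim_root n_gt0 rn1 _ sz_r); last by exists z.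
rewrite -separable.separable_prod_XsubC -Dp cyclotomic.separable_Xn_sub_1 //.
by rewrite pnatr_eq0 -lt0n.
Qed.

Lemma cabs_root_of_unity n (w : R[i]) : (0 < n)%N -> w ^+ n = 1 -> cabs w = 1.
Proof.
move=> n0 w1; have : cabs w ^+ n = 1 by rewrite -cabsX w1 cabs1.
by move/eqP; rewrite pexpr_eq1// ?cabs_ge0// => /eqP.
Qed.

Lemma sum_root_of_unity n (w : R[i]) l : n.-primitive_root w ->
  \sum_(j < n) w ^+ (j * l) = if (n %| l)%N then n%:R else 0.
Proof.
move=> wn; case: ifPn => nl.
  rewrite (eq_bigr (fun=> 1)) ?sumr_const ?card_ord// => j _.
  by apply/eqP; rewrite -(prim_order_dvd wn) dvdn_mull.
have wl : w ^+ l - 1 != 0 by rewrite subr_eq0 -(prim_order_dvd wn).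
apply: (mulfI wl); rewrite mulr0 -[RHS](subrr 1).
under eq_bigr do rewrite mulnC exprM.
by rewrite -subrX1 -exprM mulnC exprM (prim_expr_order wn) expr1n.
Qed.

End RootsOfUnity.

(** * Polynomials with vector coefficients and Cauchy's estimate *)

Section VectorPolynomials.
Context {R : realType} {H : hilbertType R}.

(** Only the coefficients of degree 0 and 1 are exposed: they determine those of the product with a
    factor 1 + z c A. The coefficients vanish from d on, so that v1 makes sense even if d <= 1. *)
Definition vector_poly (F : R[i] -> H) (v0 v1 : H) : Prop :=
  exists d (v : nat -> H), [/\ forall i, (d <= i)%N -> v i = 0,
    forall z, F z = \sum_(i < d) z ^+ i *: v i, v 0%N = v0 & v 1%N = v1].

Lemma vector_poly_cst x : vector_poly (fun=> x) x 0.
Proof.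
exists 1%N, (fun i => if i is 0%N then x else 0); split=> //.
- by case.
- by move=> z; rewrite big_ord_recl big_ord0 addr0 expr0 scale1r.
Qed.

Lemma vector_poly_linear (A : {linear H -> H}) F v0 v1 :
  vector_poly F v0 v1 -> vector_poly (fun z => A (F z)) (A v0) (A v1).
Proof.
move=> [d [v [vd FE <- <-]]]; exists d, (fun i => A (v i)); split=> //.
- by move=> i di; rewrite vd// linear0.
- by move=> z; rewrite FE linear_sum; apply: eq_bigr => i _; rewrite linearZ.
Qed.

Lemma vector_poly_step (c : R[i]) (A : {linear H -> H}) F v0 v1 :
  vector_poly F v0 v1 ->
  vector_poly (fun z => F z + (z * c) *: A (F z)) v0 (v1 + c *: A v0).
Proof.
move=> [d [v [vd FE <- <-]]].
exists d.+1, (fun i => v i + if i is j.+1 then c *: A (v j) else 0); split=> //.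
- by case=> // i di; rewrite !vd ?linear0 ?scaler0 ?addr0// ltnW.
- move=> z; rewrite !FE.
  under [RHS]eq_bigr do rewrite scalerDr.
  rewrite big_split/=; congr (_ + _).
    by rewrite big_ord_recr/= vd// scaler0 addr0.
  rewrite big_ord_recl/= scaler0 add0r linear_sum scaler_sumr.
  apply: eq_bigr => i _; rewrite linearZ/= !scalerA; congr (_ *: _).
  by rewrite /bump/= add1n exprS; ring.
- by rewrite addr0.
Qed.

Lemma vector_poly_iter (c : R[i]) (A : {linear H -> H}) k F v0 v1 :
  vector_poly F v0 v1 ->
  vector_poly (fun z => iter k (fun y => y + (z * c) *: A y) (F z))
    v0 (v1 + (k%:R * c) *: A v0).
Proof.
move=> Fv; elim: k => [|k IH]/=.
  by rewrite mul0r scale0r addr0.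
have := vector_poly_step c A IH.
rewrite -addrA -scalerDl (_ : k%:R * c + c = k.+1%:R * c)//.
by rewrite -natr1; ring.
Qed.

(* Averaging [w ^- j *: F (r * w ^ j)] over the powers of a primitive root of
   unity [w] of large order isolates the coefficient of degree one. *)
Lemma vector_poly_cauchy F v0 v1 (r B : R) : vector_poly F v0 v1 -> 0 <= r ->
  (forall z, cabs z = r -> rnorm (F z) <= B) -> r * rnorm v1 <= B.
Proof.
move=> [d [v [vd FE _ <-]]] r0 FB.
(* w ^- j is written w ^+ (j * M.-1). For i < d the exponent i + M.-1 is positive and less than 2 M,
   so that M divides it only if i = 1. *)
pose M := d.+2; have [//|w wM] := @primitive_root_exists R M.
have w1 : cabs w = 1 by apply: (@cabs_root_of_unity _ M) => //; exact: prim_expr_order.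
have key : \sum_(j < M) w ^+ (j * M.-1) *: F (r%:C * w ^+ j) = (M%:R * r)%:C *: v 1%N.
  under eq_bigr do rewrite FE scaler_sumr.
  rewrite exchange_big/=.
  transitivity (\sum_(i < d) (r%:C ^+ i * \sum_(j < M) w ^+ (j * (i + M.-1))) *: v i).
    apply: eq_bigr => i _; rewrite mulr_sumr scaler_suml; apply: eq_bigr => j _.
    rewrite scalerA exprMn -exprM mulnDr exprD; congr (_ *: _); ring.
  case: (ltnP 1 d) => d1; last first.
    rewrite vd// scaler0 big1// => i _.
    have i0 : i = 0%N :> nat by apply/eqP; rewrite -leqn0 -ltnS (leq_trans _ d1).
    rewrite (sum_root_of_unity _ wM) i0 add0n gtnNdvd// ?mulr0 ?scale0r//.
  rewrite (bigD1 (Ordinal d1))//= [X in _ + X]big1 ?addr0; last first.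
    move=> i i1; rewrite (sum_root_of_unity _ wM) ifN ?mulr0 ?scale0r//.
    have {}i1 : (i != 1 :> nat)%N by [].
    apply: contra i1 => /dvdnP[q qM].
    have iM : (i < d)%N by [].
    have : (q * d.+2 < 2 * d.+2)%N by rewrite -qM /=; lia.
    rewrite ltn_pmul2r// => q2.
    have : (0 < q * d.+2)%N by rewrite -qM /= addnS.
    rewrite muln_gt0 andbT => q0.
    have q1 : q = 1%N by lia.
    by move: qM; rewrite q1 mul1n /= addnS => -[]; lia.
  rewrite (sum_root_of_unity _ wM) add1n dvdnn expr1.
  by rewrite rmorphM/= rmorph_nat mulrC.
have M0 : 0 < M%:R :> R by rewrite ltr0n.
rewrite -(ler_pM2l M0) mulrA.
have -> : M%:R * r * rnorm (v 1%N) = rnorm ((M%:R * r)%:C *: v 1%N).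
  by rewrite rnormZr ger0_norm// mulr_ge0.
rewrite -key; apply: le_trans (rnorm_sum _ _) _.
apply: le_trans (_ : \sum_(j < M) B <= _).
  apply: ler_sum => j _; rewrite rnormZ cabsX w1 expr1n mul1r; apply: FB.
  by rewrite cabsM cabsX w1 expr1n mulr1 cabsR ger0_norm.
by rewrite sumr_const card_ord mulr_natl.
Qed.

End VectorPolynomials.

Section Fuglede.
Context {R : realType} {H : hilbertType R}.

Definition step (w : R[i]) (A : H -> H) (y : H) : H := y + w *: A y.

Lemma iter_comm (f g : H -> H) k : (forall y, f (g y) = g (f y)) ->
  forall y, iter k f (g y) = g (iter k f y).
Proof. by move=> fg y; elim: k => //= k ->. Qed.

Lemma iter_comp (f g : H -> H) k : (forall y, f (g y) = g (f y)) ->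
  forall y, iter k f (iter k g y) = iter k (f \o g) y.
Proof.
by move=> fg y; elim: k => //= k IH; rewrite (iter_comm _ fg) IH.
Qed.

Lemma step_comm w w' (A B : {linear H -> H}) : (forall y, A (B y) = B (A y)) ->
  forall y, step w A (step w' B y) = step w' B (step w A y).
Proof.
move=> AB y; rewrite /step.
have -> : A (y + w' *: B y) = A y + w' *: A (B y) by rewrite linearD linearZ.
have -> : B (y + w *: A y) = B y + w *: B (A y) by rewrite linearD linearZ.
by rewrite AB !scalerDr !scalerA (mulrC w) addrACA.
Qed.

Lemma normal_rnorm (N : bounded_op H H) : normal_op N ->
  forall x, rnorm (adjoint N x) = rnorm (N x).
Proof.
move=> Nn x; apply/eqP; rewrite -(@eqrXn2 _ 2) ?rnorm_ge0//.
by rewrite -!rinnerE radjEl -Nn rinnerC radjEl.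
Qed.

Lemma step_normal_rnorm (N : bounded_op H H) w : normal_op N ->
  forall y, rnorm (step w N y) = rnorm (step w^* (adjoint N) y).
Proof.
move=> Nn y; apply/eqP; rewrite -(@eqrXn2 _ 2) ?rnorm_ge0// !rnormD2 !rnormZ cabsJ
  normal_rnorm//.
by rewrite -rinnerZC -radjE linearZ rinnerC.
Qed.

(** The factors are exchanged one at a time: an exchanged factor commutes with the remaining ones by
    normality, and can be moved out of the way. *)
Lemma iter_step_normal_rnorm (N : bounded_op H H) w k : normal_op N ->
  forall y, rnorm (iter k (step w N) y) = rnorm (iter k (step w^* (adjoint N)) y).
Proof.
move=> Nn; elim: k => //= k IH y.
rewrite step_normal_rnorm// -iter_comm ?IH -?iterSr// => x.
by apply: step_comm => z; rewrite Nn.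
Qed.

(* The polynomial F(z) = (1 + z N^*/k)^k T (1 - z N^*/k)^k has the commutator
   [N^*, T] as coefficient of degree one.  For z of modulus r its norm does not
   change when N^* and z are replaced by N and conj z (normality), in either
   factor; as T commutes with N, F(z) is then bounded by
   |T| (1 + (r |N| / k)^2)^k, hence by e |T| once k >= (r |N|)^2. *)
Lemma fuglede (N T : bounded_op H H) : normal_op N ->
  (forall x, N (T x) = T (N x)) ->
  forall x, adjoint N (T x) = T (adjoint N x).
Proof.
move=> Nn NT x; apply/subr0_eq/rnorm0_eq0/eqP.
have [M M0 TM] := bop_bounded T; have [C C0 NC] := bop_bounded N.
set c := _ - _.
(* Liouville's argument: the bound does not depend on r. *)
suff bnd r : 0 < r -> r * rnorm c <= expR 1 * M * rnorm x.
  rewrite eq_le rnorm_ge0 andbT leNgt; apply/negP => c0.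
  pose B := expR 1 * M * rnorm x.
  have B0 : 0 <= B by rewrite !mulr_ge0 ?expR_ge0 ?rnorm_ge0// ltW.
  have := bnd ((B + 1) / rnorm c); rewrite divfK ?gt_eqF// -/B => /(_ _).
  by rewrite divr_gt0//; [lra|lra].
move=> r0.
pose k := (Num.truncn ((r * C) ^+ 2)).+1.
have kr : (r * C) ^+ 2 <= k%:R by rewrite ltW// truncnS_gt.
have k0 : 0 < k%:R :> R by rewrite ltr0n.
have kn0 : k%:R != 0 :> R[i] by rewrite pnatr_eq0.
pose As := adjoint N.
have Fp := vector_poly_iter k%:R^-1 As k (vector_poly_linear T
  (vector_poly_iter (- k%:R^-1) As k (vector_poly_cst x))).
apply: le_trans (_ : r * rnorm (T (0 + (k%:R * - k%:R^-1) *: As x) +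
  (k%:R * k%:R^-1) *: As (T x)) <= _).
  rewrite mulrN divff// add0r scale1r scaleN1r linearN addrC le_eqVlt.
  by rewrite eqxx.
apply: vector_poly_cauchy Fp (ltW r0) _ => z zr.
pose w := z * k%:R^-1.
have wr : cabs w = r / k%:R.
  rewrite cabsM zr (_ : k%:R^-1 = (k%:R^-1)%:C); last by rewrite rmorphV/=
    ?rmorph_nat// unitfE gt_eqF.
  by rewrite cabsR ger0_norm// invr_ge0 ltW.
rewrite -/w mulrN -/w.
change (rnorm (iter k (step w As) (T (iter k (step (- w) As) x))) <= expR 1 * M *
  rnorm x).
have E1 (u : R[i]) y : rnorm (iter k (step u As) y) = rnorm (iter k (step u^* N) y).
  by rewrite [RHS]iter_step_normal_rnorm// conjcK.
rewrite E1.
rewrite (@iter_comm _ T) => [|y]; last by rewrite /step linearD linearZ NT.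
apply: le_trans (TM _) _; rewrite (mulrC (expR 1)) -mulrA ler_pM2l//.
have cm (u v : R[i]) y : step u As (step v N y) = step v N (step u As y).
  by apply: step_comm => z'; rewrite /As Nn.
have cmN (u v : R[i]) y : step u N (step v N y) = step v N (step u N y).
  exact: step_comm.
(* The factors in the adjoint are moved outside, where [E1] replaces them by factors in N; the two
   kinds then pair up to 1 - (conj w N)^2, which has no term of degree one. *)
have -> : iter k (step w^* N) (iter k (step (- w) As) x) =
    iter k (step (- w) As) (iter k (step w^* N) x).
  rewrite !iter_comp => [|y|y]; rewrite ?cm//.
  by elim: (k) => //= j ->; rewrite cm.
rewrite E1 iter_comp// rmorphN/=.
have st y : rnorm (step (- w^*) N (step w^* N y)) <= (1 + (r * C / k%:R) ^+ 2) *
  rnorm y.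
  have -> : step (- w^*) N (step w^* N y) = y - (w^* ^+ 2) *: N (N y).
    rewrite /step linearD linearZ/= scalerDr scaleNr scalerA mulNr -expr2 scaleNr.
    by rewrite addrA addrK.
  apply: le_trans (rnormB _ _) _; rewrite mulrDl mul1r lerD2l rnormZ cabsX cabsJ wr.
  have -> : (r * C / k%:R) ^+ 2 * rnorm y = (r / k%:R) ^+ 2 * (C * (C * rnorm y))
    by ring.
  rewrite ler_wpM2l ?sqr_ge0//; apply: le_trans (NC _) _.
  by rewrite ler_pM2l.
have it j : rnorm (iter j (step (- w^*) N \o step w^* N) x) <=
    (1 + (r * C / k%:R) ^+ 2) ^+ j * rnorm x.
  elim: j => [|j IH]; first by rewrite expr0 mul1r.
  rewrite iterS; apply: le_trans (st _) _; rewrite [_ ^+ j.+1]exprS -[leRHS]mulrA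
    ler_wpM2l//.
  by rewrite addr_ge0// sqr_ge0.
apply: le_trans (it k) _; rewrite ler_wpM2r ?rnorm_ge0//.
apply: le_trans (_ : expR (k%:R^-1) ^+ k <= _); last first.
  by rewrite -expRM_natl divff// gt_eqF.
rewrite lerXn2r ?nnegrE ?expR_ge0// ?addr_ge0 ?sqr_ge0//.
apply: le_trans (expR_ge1Dx _); rewrite lerD2l exprMn exprVn.
by rewrite expr2 invfM mulrA ler_piMl ?invr_ge0 ?(ltW k0)// ler_pdivrMr// mul1r.
Qed.

End Fuglede.

(** * Approximate eigenvectors *)

Section ApproximateEigenvectors.
Context {R : realType} {H : hilbertType R}.
Implicit Types (a : H -> H -> R) (X : bounded_op H H).

(** If a(x, y) = Re <A x, y> with A positive, this says that A is not bounded below. *)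
Definition degenerate a : Prop :=
  forall e : R, 0 < e -> exists2 x, rnorm x = 1 & a x x <= e.

(** Holds when X commutes with the operator A of the form, since X then commutes with the square
    root of A; it is the only trace of commutation that is kept. *)
Definition form_bounded a X : Prop :=
  exists L : R, forall x, a (X x) (X x) <= L * a x x.

Definition selfadjoint X : Prop := forall x y, rinner (X x) y = rinner x (X y).

Lemma rnorm_normalize (x : H) : rnorm x != 0 -> rnorm ((rnorm x)^-1%:C *: x) = 1.
Proof.
by move=> x0; rewrite rnormZr ger0_norm ?invr_ge0 ?rnorm_ge0// mulVf.
Qed.

(* t is the infimum over C of the top of the spectrum of X - C A, where A is the
   operator of the form a. *)
Lemma degenerate_top a X : psd_form a -> degenerate a ->
  exists t : R, forall eta : R, 0 < eta ->
    (exists2 C0, 0 <= C0 & forall x, rinner (X x) x <= (t + eta) * rnorm x ^+ 2 +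
      C0 * a x x)
    /\ forall C, 0 <= C -> exists2 x, rnorm x = 1 & t - eta < rinner (X x) x - C *
      a x x.
Proof.
move=> ap ad; have [M M0 XM] := bop_bounded X.
have Xb x : rnorm x = 1 -> `|rinner (X x) x| <= M.
  by move=> x1; have := rinner_le (X x) x; have := XM x; rewrite x1 !mulr1; lra.
pose S C := [set rinner (X x) x - C * a x x | x in [set x | rnorm x = 1]].
have S0 C : S C !=set0 by have [|x x1 _] := ad 1 => //; exists (rinner (X x) x - C
  * a x x); exists x.
have SM C : 0 <= C -> ubound (S C) M.
  move=> C0 _ [x x1 <-]; have := Xb x x1; rewrite ler_norml => /andP[_].
  have := mulr_ge0 C0 (psd_ge0 ap x); lra.
have Ss C : 0 <= C -> has_sup (S C) by move=> C0; split => //; exists M; exact: SM.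
pose G := [set sup (S C) | C in [set C | 0 <= C]].
have Gi : has_inf G.
  split; first by exists (sup (S 0)); exists 0 => //=.
  exists (- M - 1) => _ [C /= C0 <-].
  have [|x x1 ax] := ad (C + 1)^-1; first by rewrite invr_gt0 ltr_wpDl.
  apply: le_trans (_ : rinner (X x) x - C * a x x <= _).
    have : C * a x x <= 1.
      apply: le_trans (ler_wpM2l C0 ax) _.
      by rewrite ler_pdivrMr ?ltr_wpDl// mul1r lerDl.
    have := Xb x x1; rewrite ler_norml => /andP[]; lra.
  by apply: ub_le_sup; [exact: (Ss C C0).2|exists x].
exists (inf G) => eta eta0; split.
  have [_ [C /= C0 <-] Ce] := inf_adherent eta0 Gi.
  exists C => // x; have [x0|x0] := eqVneq (rnorm x) 0.
    have -> := rnorm0_eq0 x0; rewrite rinner0r rnorm0 expr0n mulr0 add0r.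
    by rewrite mulr_ge0// psd_ge0.
  pose s := (rnorm x)^-1.
  have : rinner (X (s%:C *: x)) (s%:C *: x) - C * a (s%:C *: x) (s%:C *: x) <= sup
    (S C).
    apply: ub_le_sup; first exact: (Ss C C0).2.
    by exists (s%:C *: x) => //=; exact: rnorm_normalize.
  rewrite linearZ rinnerZl rinnerZr psdZl// psdZr//.
  move=> /le_lt_trans/(_ Ce) /ltW h.
  have xp : 0 < rnorm x ^+ 2 by rewrite exprn_gt0// lt_def x0 rnorm_ge0.
  have := ler_wpM2r (ltW xp) h.
  have -> : (s * (s * rinner (X x) x) - C * (s * (s * a x x))) * rnorm x ^+ 2 =
    rinner (X x) x - C * a x x by rewrite /s; field.
  by rewrite lerBlDr.
move=> C C0; have [_ [x x1 <-] xe] := sup_adherent eta0 (Ss C C0).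
exists x => //; apply: le_lt_trans xe; rewrite lerB//.
by apply: ge_inf; [exact: Gi.2|exists C].
Qed.

(* With Y = s - X, the form P(x, y) = <Y x, y> + C0 a(x, y) is positive and
   P(x, x) is small, hence so is P(x, Y x) = |Y x|^2 + C0 a(x, Y x) by
   Cauchy-Schwarz. *)
Lemma near_top_bound a (Y : {linear H -> H}) (K L C0 eta d : R) x :
  psd_form a -> (forall y z, rinner (Y y) z = rinner y (Y z)) ->
  (forall y, rnorm (Y y) <= K * rnorm y) ->
  0 <= C0 -> (forall y, 0 <= rinner (Y y) y + C0 * a y y) ->
  rnorm x = 1 -> a (Y x) (Y x) <= L * a x x -> rinner (Y x) x <= 2 * eta ->
  C0 * a x x <= eta -> C0 * (L * a x x) <= 1 -> C0 * ((1 + L) * a x x) <= eta ->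
  0 < d -> eta <= d / 2 -> 3 * eta * (K ^+ 3 + 1) <= d ^+ 2 / 4 ->
  rnorm (Y x) ^+ 2 <= d.
Proof.
move=> ap Ys YK C0_ge0 P0 x1 aY Yx A1 A2 A3 d0 etad etaK.
pose P y z := rinner (Y y) z + C0 * a y z.
have Pp : psd_form P.
  split=> [y z w|s y z|y z|y].
  - by rewrite /P linearD !rinnerDl psdDl//; ring.
  - by rewrite /P linearZ !rinnerZl psdZl//; ring.
  - by rewrite /P Ys rinnerC (psdC ap y).
  - exact: P0.
have Y1 : rnorm (Y x) <= K by have := YK x; rewrite x1 mulr1.
have K0 : 0 <= K by exact: le_trans (rnorm_ge0 _) Y1.
have Pxx : P x x <= 3 * eta.
  rewrite /P (_ : 3 * eta = 2 * eta + eta); last by ring.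
  exact: lerD.
have Pyy : P (Y x) (Y x) <= K ^+ 3 + 1.
  apply: lerD; last exact: le_trans (ler_wpM2l C0_ge0 aY) A2.
  apply: le_trans (rinner_le1 _ _) _; rewrite exprSr.
  apply: ler_pM => //; rewrite ?rnorm_ge0//; apply: le_trans (YK _) _.
  by rewrite expr2 ler_wpM2l.
have Pxy : rnorm (Y x) ^+ 2 - eta <= P x (Y x).
  rewrite /P rinnerE lerD2l lerNl.
  have h : - (2 * a x (Y x)) <= (1 + L) * a x x.
    have := psd_ge0 ap (x + Y x).
    rewrite (psdDl ap) !(psdDr ap) (psdC ap (Y x) x); move: aY; clear; lra.
  have := le_trans (ler_wpM2l C0_ge0 h) A3.
  have := mulr_ge0 C0_ge0 (psd_ge0 ap x).
  have -> : C0 * - (2 * a x (Y x)) = - (2 * (C0 * a x (Y x))) by ring.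
  by move: A1; move: (C0 * a x x) (C0 * a x (Y x)); clear => u v; lra.
have := le_trans (cauchy_schwarz x (Y x) Pp) (ler_pM (psd_ge0 Pp x) (psd_ge0 Pp _)
  Pxx Pyy).
move=> /le_trans/(_ etaK) h; rewrite leNgt; apply/negP => dq.
have : (d / 2) ^+ 2 < P x (Y x) ^+ 2.
  rewrite ltr_sqr ?nnegrE; move: d0 dq etad Pxy; clear; lra.
by rewrite ltNge; apply/negP/negPn; rewrite exprMn exprVn -natrX.
Qed.

(** A unit vector that nearly maximizes <X x, x> - C a(x, x) has a(x, x) = O(1 / C), and <X x, x>
    exceeds t - eta. So Y = t + eta - X is nearly null at x in the quadratic sense, and
    [near_top_bound] turns this into a bound on |Y x|. *)
Lemma degenerate_extend a X : psd_form a -> degenerate a -> selfadjoint X ->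
  form_bounded a X ->
  exists t : R, degenerate (fun x y => a x y +
    rinner (X x - t%:C *: x) (X y - t%:C *: y)).
Proof.
move=> ap ad Xs [L0 aL0].
have [L L_ge0 aL] : exists2 L, 0 <= L & forall x, a (X x) (X x) <= L * a x x.
  exists `|L0| => // x; apply: le_trans (aL0 x) _.
  by rewrite ler_wpM2r ?psd_ge0// ler_norm.
have [M M0 XM] := bop_bounded X.
have [t tP] := degenerate_top X ap ad; exists t => e e0.
(* For eta <= 1, K bounds the norm of Y and also C a(x, x); L' is such that a(Y x, Y x) <= L' a(x,
   x); B comes from the last hypothesis of [near_top_bound]. *)
have [K KE] : exists K, K = `|t| + 1 + M by eexists.
have K0 : 0 < K by rewrite KE ltr_wpDl// addr_ge0.
have [L' L'E] : exists L', L' = 2 * K ^+ 2 + 2 * L by eexists.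
have L'0 : 0 <= L' by rewrite L'E addr_ge0// mulr_ge0// sqr_ge0.
have [B BE] : exists B, B = 3 * (K ^+ 3 + 1) by eexists.
have B0 : 0 < B by rewrite BE mulr_gt0// ltr_wpDl// exprn_ge0// ltW.
(* At the end |X x - t x|^2 <= 2 eta^2 + 2 d <= 3 d, to which a(x, x) <= e / 2 is added. *)
have [d [d0 d1 de]] : exists d : R, [/\ 0 < d, d <= 1 & d <= e / 8].
  exists (Num.min 1 (e / 8)); split; last by rewrite ge_min lexx orbT.
    by rewrite lt_min ltr01 divr_gt0.
  by rewrite ge_min lexx.
have [eta [eta0 etad eta1 etaB]] : exists eta : R,
    [/\ 0 < eta, eta <= d / 2, eta <= 1 & eta <= d ^+ 2 / (4 * B)].
  exists (Num.min (d / 2) (Num.min 1 (d ^+ 2 / (4 * B)))).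
  split; rewrite ?ge_min ?lexx ?orbT// !lt_min ltr01 divr_gt0//=.
  by rewrite divr_gt0 ?exprn_gt0// mulr_gt0.
have [[C0 C0_ge0 C0P] CP] := tP eta eta0.
have [K_ge0 eta_ge0 e_ge0] := And3 (ltW K0) (ltW eta0) (ltW e0).
have L'1 : 0 <= 1 + L' by rewrite addr_ge0.
(* Each lower bound on C turns C a(x, x) <= K into one of the smallness conditions [A1] to [A4]. *)
have [C [C_ge0 [C1 C2 C3 C4]]] : exists C : R, 0 <= C /\ [/\ C0 * K / eta <= C,
    C0 * L' * K <= C, C0 * (1 + L') * K / eta <= C & 2 * K / e <= C].
  have c1 : 0 <= C0 * K / eta by rewrite !mulr_ge0 ?invr_ge0.
  have c2 : 0 <= C0 * L' * K by rewrite !mulr_ge0.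
  have c3 : 0 <= C0 * (1 + L') * K / eta by rewrite !mulr_ge0 ?invr_ge0.
  have c4 : 0 <= 2 * K / e by rewrite !mulr_ge0 ?invr_ge0.
  exists (C0 * K / eta + C0 * L' * K + C0 * (1 + L') * K / eta + 2 * K / e).
  move: c1 c2 c3 c4; clear.
  move: (C0 * K / eta) (C0 * L' * K) (C0 * (1 + L') * K / eta) (2 * K / e) => p q r s.
  by move=> *; do !split; lra.
have [x x1 xP] := CP C C_ge0.
have [A AE] : exists A, A = a x x by eexists.
have A0 : 0 <= A by rewrite AE psd_ge0.
have phit : t - eta < rinner (X x) x.
  by apply: lt_le_trans xP _; rewrite lerBlDr lerDl -AE mulr_ge0.
(* As t - eta < <X x, x> - C A and <X x, x> <= M. *)
have CA : C * A <= K.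
  have := rinner_le1 (X x) x; have := XM x; have := ler_norm (- t).
  move: xP eta1; rewrite normrN x1 !mulr1 -AE KE; clear.
  move: (C * A) => z; lra.
have sA s : s <= C -> s * A <= K by move=> sC; apply: le_trans CA; rewrite ler_wpM2r.
have A1 : C0 * A <= eta.
  have := sA _ C1.
  by rewrite mulrAC ler_pdivrMr// -(mulrA C0) (mulrC K A) mulrA mulrC ler_pM2l.
have A2 : C0 * (L' * A) <= 1.
  by have := sA _ C2; rewrite mulrAC -{2}[K]mul1r ler_pM2r// mulrA.
have A3 : C0 * ((1 + L') * A) <= eta.
  have := sA _ C3.
  by rewrite mulrAC ler_pdivrMr// [K * eta]mulrC mulrAC ler_pM2r// -mulrA.
have A4 : A <= e / 2.
  have := sA _ C4; rewrite mulrAC ler_pdivrMr// -mulrA mulrCA ler_pM2l//.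
  by rewrite ler_pdivlMr// mulrC.
pose y z := (t + eta)%:C *: z - X z.
have yl : linear y.
  move=> c u v; rewrite /y [X _]linearP scalerDr scalerBr !scalerA.
  by rewrite (mulrC c) opprD addrACA.
pose Y : {linear H -> H} := HB.pack y (GRing.isLinear.Build _ _ _ _ y yl).
have YE z : Y z = (t + eta)%:C *: z - X z by [].
clearbody Y; clear y yl.
have tK : `|t + eta| + M <= K.
  by have := ler_normD t eta; rewrite (gtr0_norm eta0) KE; move: eta1; clear; lra.
have YK z : rnorm (Y z) <= K * rnorm z.
  rewrite YE; apply: le_trans (rnormB _ _) _; rewrite rnormZr.
  by apply: le_trans (ler_wpM2r (rnorm_ge0 z) tK); rewrite mulrDl lerD2l.
have dq : rnorm (Y x) ^+ 2 <= d.
  apply: (near_top_bound (K := K) (L := L') (C0 := C0) (eta := eta) ap _ YK) => //.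
  - by move=> u v; rewrite !YE rinnerBl rinnerBr rinnerZl rinnerZr Xs.
  - move=> z; rewrite YE rinnerBl rinnerZl rinnerE; have := C0P z; clear; lra.
  - have := psd_ge0 ap ((t + eta)%:C *: x + X x).
    have := aL x; rewrite YE -AE.
    have : (t + eta) ^+ 2 <= K ^+ 2.
      rewrite -[leLHS]real_normK ?num_real// ler_sqr ?nnegrE//.
      by apply: le_trans tK; rewrite lerDl ltW.
    move=> /(ler_wpM2r A0); rewrite !(psdDl ap) !(psdDr ap) !(psdNl ap) !(psdNr ap).
    rewrite !(psdZl ap) !(psdZr ap) (psdC ap (X x) x) -AE L'E !expr2; clear; lra.
  - rewrite YE rinnerBl rinnerZl rinnerE x1; move: phit; clear; lra.
  - by rewrite -AE.
  - by rewrite -AE.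
  - by rewrite -AE.
  - apply: le_trans (_ : eta * B <= _); first by rewrite BE mulrCA mulrA.
    apply: le_trans (ler_wpM2r (ltW B0) etaB) _.
    have Bn : B != 0 by rewrite gt_eqF.
    by rewrite le_eqVlt; apply/orP; left; apply/eqP; field.
exists x => //; rewrite rinnerE -AE.
have -> : X x - t%:C *: x = eta%:C *: x - Y x.
  by rewrite YE rmorphD/= scalerDl opprB [RHS]addrC opprD addrA subrK.
have h1 : rnorm (eta%:C *: x - Y x) ^+ 2 <= 2 * eta ^+ 2 + 2 * d.
  have := parallelogram (eta%:C *: x) (Y x); rewrite rnormZr x1 mulr1 (gtr0_norm eta0).
  have := sqr_ge0 (rnorm (eta%:C *: x + Y x)); move: dq; clear; lra.
have h2 : eta ^+ 2 <= d / 2.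
  by apply: le_trans etad; rewrite expr2 ler_piMl.
move: A4 h1 h2 de e0; clear; lra.
Qed.

End ApproximateEigenvectors.

Section JointApproximateEigenvectors.
Context {R : realType} {H : hilbertType R}.
Implicit Types (a : H -> H -> R) (X : bounded_op H H).

Definition commuting_ops (X Y : bounded_op H H) : Prop :=
  forall x, X (Y x) = Y (X x).

(** The forms only grow, so the last one controls all |X_i x - t_i x|^2 at once. The remaining X_j
    stay bounded for the enlarged form because they commute with X_i - t. *)
Lemma degenerate_extend_seq (I : eqType) (X : I -> bounded_op H H) (s : seq I) a :
  (forall i, selfadjoint (X i)) -> (forall i j, commuting_ops (X i) (X j)) ->
  psd_form a -> degenerate a -> (forall i, form_bounded a (X i)) ->
  exists b, [/\ degenerate b, forall x, a x x <= b x x &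
    forall i, i \in s -> exists t : R, forall x, rnorm (X i x - t%:C *: x) ^+ 2 <=
      b x x].
Proof.
move=> Xs Xc; elim: s a => [|i s IH] a ap ad aX.
  by exists a.
have [t td] := degenerate_extend ap ad (Xs i) (aX i).
set a' := (fun x y => _) in td.
pose f (x : H) := X i x - t%:C *: x.
have fl : linear f.
  move=> c x y; rewrite /f linearP scalerBr !scalerDr !scalerA.
  by rewrite opprD addrACA (mulrC c).
pose F : {linear H -> H} := HB.pack f (GRing.isLinear.Build _ _ _ _ f fl).
have a'p : psd_form a'.
  apply: psdD => //; exact: (psd_comp F (@rinner_psd R H)).
have [|b [bd ab bs]] := IH a' a'p td.
  move=> j; have [L aL] := aX j; have [M M0 XM] := bop_bounded (X j).
  exists (`|L| + M ^+ 2) => x; rewrite /a'.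
  have -> : X i (X j x) - t%:C *: X j x = X j (f x).
    by rewrite /f [RHS]linearB [X in _ = _ - X]linearZ [X i _]Xc.
  rewrite !rinnerE -/(f x) mulrDl mulrDr mulrDr.
  have h1 : rnorm (X j (f x)) ^+ 2 <= M ^+ 2 * rnorm (f x) ^+ 2.
    by rewrite -exprMn ler_sqr ?nnegrE ?mulr_ge0 ?rnorm_ge0 ?(ltW M0).
  have h2 := ler_wpM2r (psd_ge0 ap x) (ler_norm L).
  have h3 : 0 <= `|L| * rnorm (f x) ^+ 2 by rewrite mulr_ge0// sqr_ge0.
  have h4 : 0 <= M ^+ 2 * a x x by rewrite mulr_ge0 ?sqr_ge0 ?psd_ge0.
  by have := aL x; lra.
exists b; split=> // [x|j].
  apply: le_trans (ab x); rewrite /a' lerDl rinnerE sqr_ge0 //.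
rewrite inE => /orP[/eqP ->|/bs//].
exists t => x; apply: le_trans (ab x); rewrite /a' rinnerE lerDr psd_ge0 //.
Qed.

End JointApproximateEigenvectors.

(** * The Taylor spectrum of normal tuples *)

Section ApproximatePointSpectrum.
Context {R : realType} {H : hilbertType R}.

Definition doubly_commuting d (U : 'I_d -> bounded_op H H) : Prop :=
  forall i j x, adjoint (U i) (U j x) = U j (adjoint (U i) x).

Lemma fuglede_tuple d (U : 'I_d -> bounded_op H H) :
  commuting U -> (forall i, normal_op (U i)) -> doubly_commuting U.
Proof. by move=> Uc Un i j x; apply: fuglede => // y; exact: Uc. Qed.

Lemma adjoint_commuting d (U : 'I_d -> bounded_op H H) : commuting U ->
  forall i j x, adjoint (U i) (adjoint (U j) x) = adjoint (U j) (adjoint (U i) x).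
Proof.
by move=> Uc i j x; apply: rinner_inj => y; rewrite !radjEl Uc.
Qed.

Lemma shift_exists d (U : 'I_d -> bounded_op H H) (z : 'I_d -> R[i]) :
  exists N : 'I_d -> bounded_op H H,
    (forall i x, N i x = U i x - z i *: x) /\
    (forall i x, adjoint (N i) x = adjoint (U i) x - (z i)^* *: x).
Proof.
have [|N NE] := @choice _ _ (fun i (N : bounded_op H H) => forall x, N x = U i x -
  z i *: x).
  move=> i; have [M M0 UM] := bop_bounded (U i).
  apply: (@bop_exists _ _ _ _ (M + cabs (z i))) => [a x y|x].
    rewrite linearP scalerBr scalerDr !scalerA [in LHS]mulrC.
    by rewrite opprD addrACA.
  apply: le_trans (rnormB _ _) _; rewrite rnormZ mulrDl.
  by rewrite lerD2r.
exists N; split=> // i; apply: adjoint_unique => x y.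
by rewrite NE rinnerBl rinnerBr radjE rinnerZC.
Qed.

Lemma shift_commute (S T : {linear H -> H}) (c e : R[i]) :
  (forall x, S (T x) = T (S x)) ->
  forall x, S (T x - e *: x) - c *: (T x - e *: x) =
    T (S x - c *: x) - e *: (S x - c *: x).
Proof.
move=> ST x.
have -> : S (T x - e *: x) = S (T x) - e *: S x by rewrite linearB linearZ.
have -> : T (S x - c *: x) = T (S x) - c *: T x by rewrite linearB linearZ.
rewrite ST !scalerBr !scalerA (mulrC e c) !opprB.
by rewrite [X in _ + X = _]addrC [X in _ = _ + X]addrC addrACA.
Qed.

Lemma koszul_shift d (U N : 'I_d -> bounded_op H H) (z : 'rV[R[i]]_d) :
  (forall i x, N i x = U i x - z 0 i *: x) ->
  forall x S, koszul U z x S =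
    \sum_(i in S) (-1) ^+ #|[set j in S | (j < i)%N]| *: N i (x (S :\ i)%SET).
Proof. by move=> NE x S; apply: eq_bigr => i _; rewrite NE. Qed.

(** * A vector that is not too orthogonal to any vector of a given sequence *)

Section GlidingHump.
Variable x : nat -> H.

(** One of the two signs of the term 4^-K x_K makes the inner product with x_K at least 4^-K in
    modulus; the later terms add up to at most a third of that, so they cannot destroy it. *)
Fixpoint hump (K : nat) : H :=
  if K is K'.+1 then
    let c : R := 4^-1 ^+ K' in
    if c <= `|rinner (hump K' + c%:C *: x K') (x K')| then hump K' + c%:C *: x K'
    else hump K' - c%:C *: x K'
  else 0.

Hypothesis x1 : forall K, rnorm (x K) = 1.

Lemma hump_ge K : 4^-1 ^+ K <= `|rinner (hump K.+1) (x K)|.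
Proof.
rewrite /=; set c := 4^-1 ^+ K; case: ifPn => //; rewrite -ltNge.
have c0 : 0 <= c by rewrite exprn_ge0// invr_ge0.
rewrite rinnerBl rinnerDl rinnerZl rinnerE x1 expr1n mulr1.
move: (rinner _ _) => p; rewrite ltr_norml => /andP[h1 h2].
have := ler_norm (- (p - c)); rewrite normrN; lra.
Qed.

Lemma hump_step K : rnorm (hump K.+1 - hump K) = 4^-1 ^+ K.
Proof.
have c0 : 0 <= 4^-1 ^+ K :> R by rewrite exprn_ge0// invr_ge0.
rewrite /=; case: ifP => _; rewrite addrC addrA addNr add0r ?rnormN rnormZr x1 mulr1.
- by rewrite ger0_norm.
- by rewrite ger0_norm.
Qed.

Lemma hump_tail K j : rnorm (hump (K + j) - hump K) <= 2 / 3 * 4^-1 ^+ K * 2.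
Proof.
have c0 n : 0 <= 4^-1 ^+ n :> R by rewrite exprn_ge0// invr_ge0.
apply: le_trans (_ : 4 / 3 * (4^-1 ^+ K - 4^-1 ^+ (K + j)) <= _); last first.
  have := c0 (K + j)%N; lra.
elim: j => [|j IH]; first by rewrite addn0 !subrr rnorm0 mulr0.
have := rnormD (hump (K + j.+1) - hump (K + j)) (hump (K + j) - hump K).
rewrite subrKA addnS hump_step; rewrite [4^-1 ^+ (K + j).+1]exprS; lra.
Qed.

Lemma gliding_hump : exists y, forall K, 4^-1 ^+ K / 2 <= `|rinner y (x K)|.
Proof.
have c0 n : 0 <= 4^-1 ^+ n :> R by rewrite exprn_ge0// invr_ge0.
have [|y yl] := @seq_cauchy_lim _ _ hump.
  move=> e e0.
  have [N NP] : exists N, 4^-1 ^+ N < e / 4 :> R.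
    have [|N NP] := @inv_lt R (e / 4); first by rewrite divr_gt0.
    exists N; apply: le_lt_trans (NP N (leqnn _)); rewrite exprVn.
    rewrite lef_pV2 ?posrE ?exprn_gt0// -natrX ler_nat.
    exact: ltn_expl.
  exists N => m n Nm Nn.
  have := hump_tail N (m - N); have := hump_tail N (n - N); rewrite !subnKC//.
  have := rnormB (hump m - hump N) (hump n - hump N).
  rewrite opprB addrA subrK; move: NP; move: (4^-1 ^+ N) => c; lra.
exists y => K.
have tl : rnorm (y - hump K.+1) <= 4^-1 ^+ K / 3.
  apply/ler_addgt0Pr => e e0; have [N NP] := yl e e0.
  pose n := (K.+1 + N)%N; have := NP n (leq_addl _ _).
  have := rnormD (y - hump n) (hump n - hump K.+1); rewrite subrKA (rnorm_distC y).
  by have := hump_tail K.+1 N; rewrite -/n exprS; move: (4^-1 ^+ K) => c; lra.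
have := hump_ge K; have := rinner_le (y - hump K.+1) (x K); rewrite x1 mulr1 rinnerBl.
move: (rinner y _) (rinner (hump _) _) (4^-1 ^+ K) tl (c0 K) => p q c tl cK h1 h2.
have := ler_normD p (q - p); rewrite addrC subrK distrC; lra.
Qed.

End GlidingHump.

Definition approx_eigenvalue d (U : 'I_d -> bounded_op H H) (z : 'I_d -> R[i]) : Prop :=
  forall e : R, 0 < e -> exists2 x, rnorm x = 1 &
    forall i, rnorm (U i x - z i *: x) <= e.

(* Exactness in top degree means that every y is a sum of elements
   (U_i - z_i) y_i; such a sum is almost orthogonal to the approximate
   eigenvectors, which a gliding hump prevents for a suitable y. *)
Lemma approx_eigenvalue_spectrum d (U : 'I_d -> bounded_op H H) (z : 'rV[R[i]]_d) :
  (forall i, normal_op (U i)) ->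
  approx_eigenvalue U (fun i => z 0 i) -> joint_spectrum U z.
Proof.
move=> Un Uz ex.
have [N [NE NaE]] := shift_exists U (fun i => z 0 i).
have Nn i : normal_op (N i).
  by move=> x; rewrite !NE !NaE; exact: shift_commute (Un i) x.
(* The rate 8^-K beats the lower bound 4^-K / 2 of [gliding_hump]. *)
have [u uP] : exists u : nat -> H, forall K, rnorm (u K) = 1 /\
    forall i, rnorm (N i (u K)) <= 8^-1 ^+ K.
  have [|u uP] := @choice nat H (fun K x => rnorm x = 1 /\
    forall i, rnorm (N i x) <= 8^-1 ^+ K); last by exists u.
  move=> K; have [|x x1 xP] := Uz (8^-1 ^+ K); first by rewrite exprn_gt0// invr_gt0.
  by exists x; split=> // i; rewrite NE.
have [y yP] := @gliding_hump u (fun K => (uP K).1).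
(* Put in top degree, y is a cocycle, since no S :\ i is the full set. *)
pose x (S : {set 'I_d}) : H := if S == [set: 'I_d]%SET then y else 0.
have [|w wP] := ex x.
  move=> S; rewrite (koszul_shift NE) big1// => i iS.
  rewrite /x ifF ?linear0 ?scaler0//; apply/eqP => /setP/(_ i).
  by rewrite !inE eqxx.
have := wP [set: 'I_d]%SET; rewrite {1}/x eqxx (koszul_shift NE) => yE.
pose B := \sum_(i in [set: 'I_d]%SET) rnorm (w ([set: 'I_d] :\ i)%SET).
have B0 : 0 <= B by apply: sumr_ge0 => i _; exact: rnorm_ge0.
have yB K : `|rinner y (u K)| <= B * 8^-1 ^+ K.
  rewrite yE; set s := \sum_(i in _) _.
  have -> : rinner s (u K) = \sum_(i in [set: 'I_d]%SET) rinner
      ((-1) ^+ #|[set j in [set: 'I_d] | (j < i)%N]%SET| *: N i (w ([set: 'I_d] :\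
        i)%SET)) (u K).
    rewrite /s; elim/big_rec2 : _ => [|i a b _ <-]; first by rewrite rinner0l.
    by rewrite rinnerDl.
  apply: le_trans (ler_norm_sum _ _ _) _; rewrite /B mulr_suml.
  apply: ler_sum => i _; set sg := _ ^+ _; set v := w _.
  rewrite rinnerZC radjE linearZ/=.
  apply: le_trans (rinner_le _ _) _; rewrite ler_wpM2l ?rnorm_ge0//.
  rewrite rnormZ cabsJ /sg cabsX cabsN cabs1 expr1n mul1r normal_rnorm//.
  exact: (uP K).2.
pose K := (Num.truncn (2 * B)).+1.
have KB : 2 * B < K%:R by exact: truncnS_gt.
have := le_trans (yP K) (yB K); apply/negP; rewrite -ltNge.
have -> : 4^-1 ^+ K / 2 = 2^-1 * 2 ^+ K * 8^-1 ^+ K :> R.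
  have e48 : 2 * 8^-1 = 4^-1 :> R by field.
  by rewrite -mulrA -exprMn e48 mulrC.
rewrite ltr_pM2r ?exprn_gt0 ?invr_gt0//.
have : K%:R < 2 ^+ K :> R by rewrite -natrX ltr_nat ltn_expl.
move: KB; move: (K%:R) (2 ^+ K) => a b; lra.
Qed.

End ApproximatePointSpectrum.

(** * Exactness of the Koszul complex of a doubly commuting tuple bounded below *)

Section Koszul.
Context {R : realType} {H : hilbertType R}.

(** Lax-Milgram: coercivity makes the range closed and its orthogonal complement zero. *)
Lemma positive_surjective (A : bounded_op H H) (e : R) : 0 < e ->
  (forall x, e * rnorm x ^+ 2 <= rinner (A x) x) -> forall y, exists x, A x = y.
Proof.
move=> e0 Ae y.
have Ab x : e * rnorm x <= rnorm (A x).
  have [x0|x0] := eqVneq (rnorm x) 0; first by rewrite x0 mulr0 rnorm_ge0.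
  have xp : 0 < rnorm x by rewrite lt_def x0 rnorm_ge0.
  rewrite -(ler_pM2r xp) -mulrA -expr2; apply: le_trans (Ae x) _.
  exact: rinner_le1.
have [q qA qo] := orthogonal_projection (ran_closure A) y.
have yq : y = q.
  apply/subr0_eq/rnorm0_eq0/eqP; rewrite -sqrf_eq0 eq_le sqr_ge0 andbT.
  rewrite -(ler_pM2l e0) mulr0; apply: le_trans (Ae _) _.
  by rewrite rinnerC qo//=; apply: subset_closure; exists (y - q).
have yA : closure (range A) y by rewrite yq.
have [u uP] : exists u : nat -> H, forall n, rnorm (A (u n) - y) < n.+1%:R^-1.
  apply: (@seq_of_eps _ _ (fun e x => rnorm (A x - y) < e)) => c c0.
  by have /closureP/(_ c c0)[_ [x _ <-] xy] := yA; exists x.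
have {}uP c : 0 < c -> exists N, forall n, (N <= n)%N -> rnorm (A (u n) - y) < c.
  move=> /inv_lt[N NP]; exists N => n Nn; exact: lt_trans (uP n) (NP n Nn).
have [|x ux] := @seq_cauchy_lim _ _ u.
  move=> c c0; have [|N NP] := uP (e * c / 2); first by rewrite divr_gt0// mulr_gt0.
  exists N => m n Nm Nn; rewrite -(ltr_pM2l e0); apply: le_lt_trans (Ab _) _.
  have := rnormB (A (u m) - y) (A (u n) - y).
  have -> : A (u m) - y - (A (u n) - y) = A (u m - u n).
    by rewrite [RHS]linearB opprB addrA subrK.
  by have := NP m Nm; have := NP n Nn; lra.
exists x; apply/subr0_eq/rnorm0_eq0/eqP; rewrite eq_le rnorm_ge0 andbT.
have [M M0 AM] := bop_bounded A.
apply/ler_addgt0Pr => c c0; rewrite add0r.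
have [|N NP] := uP (c / 2); first by rewrite divr_gt0.
have [|N' NP'] := ux (c / (2 * M)); first by rewrite divr_gt0// mulr_gt0.
pose n := maxn N N'.
have := NP n (leq_maxl _ _); have := NP' n (leq_maxr _ _).
rewrite ltr_pdivlMr ?mulr_gt0//.
have := AM (u n - x); rewrite linearB.
have := rnormB (A (u n) - y) (A (u n) - A x).
have -> : A (u n) - y - (A (u n) - A x) = A x - y.
  by rewrite opprB addrC addrA subrK.
lra.
Qed.

Definition ksign d (i : 'I_d) (S : {set 'I_d}) : R[i] :=
  (-1) ^+ #|[set j in S | (j < i)%N]|.

Lemma ksign_sqr d (i : 'I_d) S : ksign i S * ksign i S = 1.
Proof. by rewrite -expr2 /ksign sqrr_sign. Qed.

Lemma ksignD1 d (i l : 'I_d) (S : {set 'I_d}) : i \in S ->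
  ksign l (S :\ i)%SET = (-1) ^+ (i < l)%N * ksign l S.
Proof.
move=> iS; rewrite /ksign (cardsD1 i [set j in S | (j < l)%N]%SET) inE iS/=.
rewrite exprD mulrA -expr2 sqrr_sign mul1r; congr (_ ^+ #|pred_of_set _|).
by apply/setP => j; rewrite !inE andbA.
Qed.

Lemma ksignU1 d (i l : 'I_d) (S : {set 'I_d}) : l \notin S ->
  ksign i (l |: S)%SET = (-1) ^+ (l < i)%N * ksign i S.
Proof.
move=> lS; rewrite -{2}(setU1K lS) ksignD1 ?setU11// mulrA -expr2 sqrr_sign mul1r.
by [].
Qed.

(* Contraction with N_l^* A^-1, A = sum_i N_i^* N_i, is a homotopy between the
   identity and zero on the Koszul complex of N. *)
Lemma koszul_homotopy d (N : 'I_d -> bounded_op H H) (G : {linear H -> H}) :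
  doubly_commuting N ->
  (forall i x, G (N i x) = N i (G x)) ->
  (forall i x, G (adjoint (N i) x) = adjoint (N i) (G x)) ->
  (forall x, \sum_i N i (adjoint (N i) (G x)) = x) ->
  forall x : {set 'I_d} -> H,
  (forall S : {set 'I_d}, \sum_(i in S) ksign i S *: N i (x (S :\ i)%SET) = 0) ->
  exists y : {set 'I_d} -> H,
  forall S : {set 'I_d}, x S = \sum_(i in S) ksign i S *: N i (y (S :\ i)%SET).
Proof.
move=> Ndc GN GNa GA x x0.
exists (fun S : {set 'I_d} => \sum_(l | l \notin S) ksign l S *: adjoint (N l) (G
  (x (l |: S)%SET))).
move=> S.
pose W i l := N i (adjoint (N l) (G (x (l |: (S :\ i))%SET))).
(* The cocycle condition at l |: S, solved for its term in x S. *)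
have cross l : l \notin S -> adjoint (N l) (N l (G (x S))) =
    \sum_(i in S) (ksign i S * ksign l (S :\ i)%SET) *: W i l.
  move=> lS.
  have := x0 (l |: S)%SET; rewrite big_setU1//= setU1K// => /eqP.
  rewrite addr_eq0 => /eqP /(congr1 (fun v => ksign l S *: adjoint (N l) (G v))).
  rewrite ksignU1// ltnn expr0 mul1r.
  have -> : ksign l S *: adjoint (N l) (G (ksign l S *: N l (x S))) =
      adjoint (N l) (N l (G (x S))).
    by rewrite [G _]linearZ [adjoint _ _]linearZ scalerA ksign_sqr scale1r/= GN.
  move=> ->; rewrite [G _]linearN linear_sum [adjoint _ _]linearN linear_sum
    scalerN scaler_sumr -sumrN.
  apply: eq_bigr => i iS.
  have il : i != l by apply: contraNneq lS => <-.
  have -> : ((l |: S) :\ i)%SET = (l |: (S :\ i))%SET.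
    apply/setP => j; rewrite !inE; case: (eqVneq j l) => //= ->.
    by rewrite eq_sym il.
  rewrite [G _]linearZ [adjoint _ _]linearZ scalerA -scaleNr GN Ndc /W; congr (_ *: _).
  (* Exactly one of i < l and l < i holds, which produces the minus sign of the homotopy. *)
  rewrite ksignU1// ksignD1//.
  have : (i != l :> nat) by [].
  by case: ltngtP => // _ _; rewrite expr0 expr1; ring.
have E i : i \in S -> ksign i S *: N i (\sum_(l | l \notin (S :\ i)%SET)
      ksign l (S :\ i)%SET *: adjoint (N l) (G (x (l |: (S :\ i))%SET))) =
    N i (adjoint (N i) (G (x S))) +
    \sum_(l | l \notin S) (ksign i S * ksign l (S :\ i)%SET) *: W i l.
  move=> iS; rewrite (bigD1 i) ?setD11//= linearD scalerDr; congr (_ + _).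
    rewrite [N i _]linearZ scalerA ksignD1// ltnn expr0 mul1r ksign_sqr scale1r.
    by rewrite finset.setD1K.
  rewrite linear_sum scaler_sumr; apply: eq_big => [l|l _].
    rewrite !inE negb_and negbK; case: (eqVneq l i) => [->|]; rewrite ?iS ?andbF//=.
    by rewrite andbT.
  by rewrite [N i _]linearZ scalerA.
(* The diagonal terms give the indices in S and the cross terms those outside; together they form
   sum_i N_i N_i^* G (x S) = x S. *)
rewrite (eq_bigr _ E) big_split/= exchange_big/=.
rewrite -(eq_bigr _ cross) -[LHS]GA (bigID (mem S))/=; congr (_ + _).
by apply: eq_bigr => l _; rewrite Ndc.
Qed.

Lemma koszul_exact_bounded_below d (U : 'I_d -> bounded_op H H) (z : 'rV[R[i]]_d)
    (N : 'I_d -> bounded_op H H) (e : R) :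
  (forall i x, N i x = U i x - z 0 i *: x) ->
  commuting N -> doubly_commuting N -> 0 < e ->
  (forall x, e * rnorm x ^+ 2 <= \sum_i rnorm (N i x) ^+ 2) -> koszul_exact U z.
Proof.
move=> NE Nc Ndc e0 Ne.
(* By [Ndc] the order of the factors is immaterial: [koszul_homotopy] uses this one, the lower bound
   [Ne] the other. *)
pose f x := \sum_i N i (adjoint (N i) x).
have fl : linear f.
  move=> a x y; rewrite /f scaler_sumr -big_split; apply: eq_bigr => i _.
  by rewrite !linearP.
have [A AE] : exists A : bounded_op H H, forall x, A x = f x.
  have [M MP] : exists M : 'I_d -> R, forall i x, rnorm (N i (adjoint (N i) x)) <=
    M i * rnorm x.
    have [|M MP] := @choice _ _ (fun i (m : R) => forall x, rnorm (N i (adjoint (N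
      i) x)) <= m * rnorm x).
      move=> i; have [M M0 NM] := bop_bounded (bop_comp (N i) (adjoint (N i))).
      by exists M => x; exact: NM.
    by exists M.
  apply: (@bop_exists _ _ _ f (\sum_i M i)) => // x.
  apply: le_trans (rnorm_sum _ _) _; rewrite mulr_suml; apply: ler_sum => i _.
  exact: MP.
have Ae x : e * rnorm x ^+ 2 <= rinner (A x) x.
  apply: le_trans (Ne x) _; rewrite AE /f le_eqVlt; apply/orP; left; apply/eqP.
  elim/big_rec2 : _ => [|i s v _ ->]; first by rewrite rinner0l.
  by rewrite rinnerDl -Ndc radjEl rinnerE.
have A_inj x y : A x = A y -> x = y.
  move=> Axy; apply/subr0_eq/rnorm0_eq0/eqP; rewrite -sqrf_eq0 eq_le sqr_ge0 andbT.
  rewrite -(ler_pM2l e0) mulr0; apply: le_trans (Ae _) _.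
  by rewrite linearB Axy subrr rinner0l.
have [g gA] := @choice _ _ (fun y x => A x = y) (positive_surjective e0 Ae).
have gl : linear g by move=> a x y; apply: A_inj; rewrite linearP !gA.
pose G : {linear H -> H} := HB.pack g (GRing.isLinear.Build _ _ _ _ g gl).
have AN i x : A (N i x) = N i (A x).
  rewrite !AE /f linear_sum; apply: eq_bigr => j _.
  by rewrite Ndc Nc.
have ANa i x : A (adjoint (N i) x) = adjoint (N i) (A x).
  rewrite !AE /f linear_sum; apply: eq_bigr => j _.
  by rewrite Ndc adjoint_commuting.
move=> x x0; have [||||y yP] := @koszul_homotopy _ N G Ndc _ _ _ x.
- by move=> i v; apply: A_inj; rewrite AN !gA.
- by move=> i v; apply: A_inj; rewrite ANa !gA.
- by move=> v; rewrite -[RHS]gA AE.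
- by move=> S; rewrite -[RHS](x0 S) (koszul_shift NE).
by exists y => S; rewrite (koszul_shift NE).
Qed.

End Koszul.

(** * Localization at the joint spectrum *)

Section NormalTuples.
Context {R : realType} {H : hilbertType R} (d : nat).
Variable U : 'I_d -> bounded_op H H.

(** It contains the real and imaginary parts of the U_i, so a form that all its members leave
    bounded can be localized. *)
Definition commutant (W : bounded_op H H) : Prop :=
  (forall i x, W (U i x) = U i (W x)) /\
  (forall i x, W (adjoint (U i) x) = adjoint (U i) (W x)).

Lemma commutant_adjoint W : commutant W -> commutant (adjoint W).
Proof.
move=> [WU WUa]; split=> i x; apply: rinner_inj => y.
- by rewrite radjEl [LHS]radjE [RHS]radjE radjEl WUa.
- by rewrite !radjEl WU.
Qed.

Lemma form_bounded_comm (N : {linear H -> H}) (W : bounded_op H H) :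
  (forall x, N (W x) = W (N x)) ->
  form_bounded (fun x y => rinner (N x) (N y)) W.
Proof.
move=> NW; have [M M0 WM] := bop_bounded W; exists (M ^+ 2) => x.
by rewrite NW !rinnerE -exprMn ler_sqr ?nnegrE ?mulr_ge0 ?rnorm_ge0 ?(ltW M0).
Qed.

Hypothesis Uc : commuting U.
Hypothesis Un : forall i, normal_op (U i).

Lemma real_imaginary_parts : exists X : bool * 'I_d -> bounded_op H H,
  [/\ forall bi, selfadjoint (X bi), forall bi ci, commuting_ops (X bi) (X ci),
    forall bi, commutant (X bi) &
    forall i x, U i x = X (true, i) x + 'i *: X (false, i) x].
Proof.
pose c (b : bool) : R[i] := if b then 2^-1 else - 'i / 2.
have Udc := fuglede_tuple Uc Un.
have Uac := adjoint_commuting Uc.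
have [X XE] : exists X : bool * 'I_d -> bounded_op H H,
    forall b i x, X (b, i) x = c b *: U i x + (c b)^* *: adjoint (U i) x.
  have [|X XE] := @choice _ _ (fun (bi : bool * 'I_d) (X : bounded_op H H) =>
      forall x, X x = c bi.1 *: U bi.2 x + (c bi.1)^* *: adjoint (U bi.2) x).
    move=> [b i] /=; have [M M0 UM] := bop_bounded (U i).
    have [M' M'0 UM'] := bop_bounded (adjoint (U i)).
    apply: (@bop_exists _ _ _ _ (cabs (c b) * M + cabs (c b) * M')) => [a x y|x].
      rewrite [U i _]linearP [adjoint _ _]linearP !scalerDr !scalerA.
      rewrite [a * c b]mulrC [a * _^*]mulrC.
      by rewrite addrACA.
    apply: le_trans (rnormD _ _) _; rewrite !rnormZ cabsJ mulrDl -!mulrA.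
    by apply: lerD; rewrite ler_wpM2l ?cabs_ge0.
  by exists X => b i x; rewrite XE.
have lin (T : bounded_op H H) (a e : R[i]) (x y : H) : T (a *: x + e *: y) = a *: T
  x + e *: T y.
  by rewrite linearP [T (e *: _)]linearZ.
exists X; split.
- move=> [b i] x y; rewrite !XE rinnerDl rinnerDr !rinnerZC conjCK radjEl [X in X +
  _]radjE.
  by rewrite [U i (_ *: _)]linearZ [adjoint _ (_ *: _)]linearZ addrC.
- move=> [b i] [b' j] x; rewrite !XE !lin !Udc (Uac i j) (Uc i j).
  rewrite !scalerDr !scalerA addrACA.
  by congr (_ + _ + (_ + _)); congr (_ *: _); exact: mulrC.
- move=> [b i]; split=> j x; rewrite !XE lin; congr (_ *: _ + _ *: _).
  + exact: Uc.
  + by rewrite Udc.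
  + by rewrite Udc.
  + exact: Uac.
- move=> i x; rewrite !XE scalerDr !scalerA addrACA -!scalerDl.
  have -> : c true + 'i * c false = 1.
    by rewrite /c mulrA mulrN -expr2 sqr_i opprK [RHS]splitr div1r.
  have -> : (c true)^* + 'i * (c false)^* = 0.
    have ci : Num.conj ('i : R[i]) = - 'i.
      by apply/eqP; rewrite eq_complex/= oppr0 !eqxx.
    rewrite /c rmorphM rmorphN !fmorphV !rmorph_nat/= ci opprK mulrA -expr2 sqr_i.
    by rewrite mulN1r subrr.
  by rewrite scale1r scale0r addr0.
Qed.

(** Where b is small, a is small and every U_i is close to the scalar z_i. The 4 comes from |u + i
    v|^2 <= 2 |u|^2 + 2 |v|^2, with both squares at most b. *)
Lemma normal_localize a : psd_form a -> degenerate a ->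
  (forall W, commutant W -> form_bounded a W) ->
  exists b (z : 'rV[R[i]]_d), [/\ degenerate b, forall x, a x x <= b x x &
    forall i x, rnorm (U i x - z 0 i *: x) ^+ 2 <= 4 * b x x].
Proof.
move=> ap ad aW; have [X [Xs Xc XW UX]] := real_imaginary_parts.
have [b [bd ab bX]] := degenerate_extend_seq (enum {: bool * 'I_d}) Xs Xc ap ad
  (fun bi => aW _ (XW bi)).
have [|t tP] := @choice (bool * 'I_d) R (fun bi t => forall x,
    rnorm (X bi x - t%:C *: x) ^+ 2 <= b x x).
  by move=> bi; apply: bX; rewrite mem_enum.
exists b, (\row_i ((t (true, i))%:C + 'i * (t (false, i))%:C)); split=> // i x.
rewrite mxE UX.
set u := X (true, i) x - (t (true, i))%:C *: x.
set v := X (false, i) x - (t (false, i))%:C *: x.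
have -> : X (true, i) x + 'i *: X (false, i) x -
    ((t (true, i))%:C + 'i * (t (false, i))%:C) *: x = u + 'i *: v.
  by rewrite /u /v scalerDl opprD addrACA scalerBr scalerA.
have nv : rnorm ('i *: v) = rnorm v.
  by rewrite rnormZ cabsi mul1r.
have := parallelogram u ('i *: v); rewrite nv.
have := sqr_ge0 (rnorm (u - 'i *: v)).
have := tP (true, i) x; have := tP (false, i) x; rewrite -/u -/v; lra.
Qed.

Lemma degenerate_approx b (z : 'rV[R[i]]_d) : degenerate b ->
  (forall i x, rnorm (U i x - z 0 i *: x) ^+ 2 <= 4 * b x x) ->
  forall e : R, 0 < e -> exists x, [/\ rnorm x = 1, b x x <= e &
    forall i, rnorm (U i x - z 0 i *: x) <= e].
Proof.
move=> bd bz e e0; pose c := Num.min e (e ^+ 2 / 4).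
have c0 : 0 < c by rewrite lt_min e0 divr_gt0// exprn_gt0.
have [x x1 bx] := bd c c0; exists x; split=> //.
  by apply: le_trans bx _; rewrite ge_min lexx.
move=> i; rewrite -ler_sqr ?nnegrE ?rnorm_ge0 ?(ltW e0)//; apply: le_trans (bz i x) _.
have : c <= e ^+ 2 / 4 by rewrite ge_min lexx orbT.
lra.
Qed.

Lemma localize_spectrum b (z : 'rV[R[i]]_d) : degenerate b ->
  (forall i x, rnorm (U i x - z 0 i *: x) ^+ 2 <= 4 * b x x) ->
  joint_spectrum U z.
Proof.
move=> bd bz; apply: approx_eigenvalue_spectrum => // e e0.
by have [x [x1 _ xe]] := degenerate_approx bd bz e0; exists x.
Qed.

(* T acts as the scalar c on the approximate eigenvectors of U at z. *)
Definition symbol (z : 'rV[R[i]]_d) (T : H -> H) (c : R[i]) : Prop :=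
  forall e : R, 0 < e -> exists2 r : R, 0 < r & forall x, rnorm x = 1 ->
    (forall i, rnorm (U i x - z 0 i *: x) <= r) -> rnorm (T x - c *: x) <= e.

Lemma symbol_coord z i : symbol z (U i) (z 0 i).
Proof. by move=> e e0; exists e. Qed.

Lemma symbol_adjoint z i : symbol z (adjoint (U i)) (z 0 i)^*.
Proof.
move=> e e0; exists e => // x x1 xe.
have [N [NE NaE]] := shift_exists U (fun i => z 0 i).
have Nn : normal_op (N i).
  by move=> y; rewrite !NE !NaE; exact: shift_commute (Un i) y.
by rewrite -NaE normal_rnorm// NE.
Qed.

Lemma symbol_id z : symbol z id 1.
Proof. by move=> e e0; exists 1 => // x _ _; rewrite scale1r subrr rnorm0 ltW. Qed.

Lemma symbol_comp z (S : bounded_op H H) (T : H -> H) s t :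
  symbol z S s -> symbol z T t -> symbol z (fun x => S (T x)) (s * t).
Proof.
move=> Ss Tt e e0; have [M M0 SM] := bop_bounded S.
have [|r r0 rP] := Tt (e / (2 * M)); first by rewrite divr_gt0// mulr_gt0.
have t1 : 0 < cabs t + 1 by rewrite ltr_wpDl// cabs_ge0.
have [|r' r'0 r'P] := Ss (e / (2 * (cabs t + 1))); first by rewrite divr_gt0// mulr_gt0.
exists (Num.min r r'); first by rewrite lt_min r0.
move=> x x1 xr.
have -> : S (T x) - (s * t) *: x = S (T x - t *: x) + t *: (S x - s *: x).
  rewrite linearB [S (t *: x)]linearZ scalerBr scalerA mulrC.
  by rewrite addrA subrK.
have /rP : forall i, rnorm (U i x - z 0 i *: x) <= r.
  by move=> i; apply: le_trans (xr i) _; rewrite ge_min lexx.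
move=> /(_ x1) h1.
have /r'P : forall i, rnorm (U i x - z 0 i *: x) <= r'.
  by move=> i; apply: le_trans (xr i) _; rewrite ge_min lexx orbT.
move=> /(_ x1) h2; apply: le_trans (rnormD _ _) _; rewrite rnormZ.
have -> : e = e / 2 + e / 2 by field.
apply: lerD.
  apply: le_trans (SM _) _; rewrite mulrC -ler_pdivlMr//.
  by apply: le_trans h1 _; rewrite le_eqVlt; apply/orP; left; apply/eqP; field;
    rewrite gt_eqF.
apply: le_trans (_ : (cabs t + 1) * rnorm (S x - s *: x) <= _).
  by rewrite ler_wpM2r ?rnorm_ge0// lerDl.
rewrite mulrC -ler_pdivlMr//; apply: le_trans h2 _.
by rewrite le_eqVlt; apply/orP; left; apply/eqP; field; rewrite gt_eqF.
Qed.

Lemma symbolB z (S T : H -> H) s t :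
  symbol z S s -> symbol z T t -> symbol z (fun x => S x - T x) (s - t).
Proof.
move=> Ss Tt e e0.
have [|r r0 rP] := Tt (e / 2); first by rewrite divr_gt0.
have [|r' r'0 r'P] := Ss (e / 2); first by rewrite divr_gt0.
exists (Num.min r r'); first by rewrite lt_min r0.
move=> x x1 xr.
have /rP : forall i, rnorm (U i x - z 0 i *: x) <= r.
  by move=> i; apply: le_trans (xr i) _; rewrite ge_min lexx.
move=> /(_ x1) h1.
have /r'P : forall i, rnorm (U i x - z 0 i *: x) <= r'.
  by move=> i; apply: le_trans (xr i) _; rewrite ge_min lexx orbT.
move=> /(_ x1) h2.
have -> : S x - T x - (s - t) *: x = S x - s *: x - (T x - t *: x).
  by rewrite scalerBl !opprB [t *: x - s *: x]addrC addrACA [- T x + _]addrC.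
apply: le_trans (rnormB _ _) _; lra.
Qed.

Lemma symbol_exp z i p : symbol z (bop_exp (U i) p) (z 0 i ^+ p).
Proof.
elim: p => [|p IH]; first exact: symbol_id.
by rewrite exprS; apply: symbol_comp IH; exact: symbol_coord.
Qed.

(* If B did not vanish, s - B^* B with s = |B|^2 would be degenerate, hence
   localize at a point of the joint spectrum, where B is close to 0. *)
Lemma operator_vanish (B : bounded_op H H) :
  (forall W, commutant W -> forall x, W (B x) = B (W x)) ->
  (forall z, joint_spectrum U z -> symbol z B 0) -> forall x, B x = 0.
Proof.
move=> BW B0 x0; apply: rnorm0_eq0; apply/eqP; apply/negPn/negP => Bx0.
have [M M0 BM] := bop_bounded B.
have BaM x : rnorm (adjoint B x) <= M * rnorm x.
  have [->|ax0] := eqVneq (rnorm (adjoint B x)) 0.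
    by rewrite mulr_ge0 ?rnorm_ge0// ltW.
  have ap : 0 < rnorm (adjoint B x) by rewrite lt_def ax0 rnorm_ge0.
  rewrite -(ler_pM2r ap) -expr2 -rinnerE radjEl.
  apply: le_trans (rinner_le1 _ _) _; rewrite mulrC.
  by have := ler_wpM2r (rnorm_ge0 x) (BM (adjoint B x)); lra.
have x00 : rnorm x0 != 0.
  by apply: contra_neq Bx0 => /rnorm0_eq0 ->; rewrite linear0 rnorm0.
pose D := [set rnorm (B x) ^+ 2 | x in [set x | rnorm x = 1]].
have Ds : has_sup D.
  split.
    exists (rnorm (B ((rnorm x0)^-1%:C *: x0)) ^+ 2).
    by exists ((rnorm x0)^-1%:C *: x0) => //; exact: rnorm_normalize.
  exists (M ^+ 2) => _ [x /= x1 <-]; rewrite ler_sqr ?nnegrE ?rnorm_ge0 ?(ltW M0)//.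
  by have := BM x; rewrite x1 mulr1.
pose s := sup D.
have Bs x : rnorm x = 1 -> rnorm (B x) ^+ 2 <= s.
  by move=> x1; apply: ub_le_sup; [exact: Ds.2|exists x].
have s0 : 0 < s.
  apply: lt_le_trans (Bs _ (rnorm_normalize x00)).
  rewrite exprn_even_gt0//= [B _]linearZ rnormZr mulf_neq0//.
  by rewrite normr_eq0 invr_eq0.
have Bs2 x : rnorm (B x) ^+ 2 <= s * rnorm x ^+ 2.
  have [xz|xz] := eqVneq (rnorm x) 0.
    by rewrite (rnorm0_eq0 xz) linear0 rnorm0 expr0n mulr0.
  have := Bs _ (rnorm_normalize xz).
  rewrite [B _]linearZ rnormZr exprMn real_normK ?num_real// exprVn.
  by rewrite mulrC ler_pdivrMr// exprn_even_gt0.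
pose f x := s%:C *: x - adjoint B (B x).
have fl : linear f.
  move=> c x y; rewrite /f [B _]linearP [adjoint B _]linearP scalerDr scalerBr !scalerA.
  by rewrite (mulrC c) opprD addrACA.
pose N : {linear H -> H} := HB.pack f (GRing.isLinear.Build _ _ _ _ f fl).
(* The form |N x|^2, rather than <N x, x>, is bounded for every W that commutes with N, by
   [form_bounded_comm]. *)
pose a x y := rinner (N x) (N y).
have ap : psd_form a by exact: psd_comp (@rinner_psd R H).
have ad : degenerate a.
  (* As |B^* B x| <= s on unit vectors, |N x|^2 <= 2 s (s - |B x|^2). *)
  move=> e e0; have e2 : 0 < e / (2 * s) by rewrite divr_gt0// mulr_gt0.
  have [_ [x /= x1 <-] xs] := sup_adherent e2 Ds.
  exists x => //; rewrite /a rinnerE /N/= /f rnormB2 rnormZr (gtr0_norm s0) x1 mulr1.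
  rewrite rinnerZl -radjE rinnerE.
  have h : rnorm (adjoint B (B x)) ^+ 2 <= s * s.
    have [->|az] := eqVneq (rnorm (adjoint B (B x))) 0.
      by rewrite expr0n /= mulr_ge0// ltW.
    have ap' : 0 < rnorm (adjoint B (B x)) ^+ 2.
      by rewrite exprn_even_gt0.
    rewrite -(ler_pM2l ap') -expr2 -{1}rinnerE radjEl.
    have := rinner_le1 (B x) (B (adjoint B (B x))).
    set q := rinner _ _ => qb.
    have q0 : 0 <= q by rewrite /q -radjEl rinnerE sqr_ge0.
    have : q ^+ 2 <= rnorm (B x) ^+ 2 * rnorm (B (adjoint B (B x))) ^+ 2.
      by rewrite -exprMn ler_sqr ?nnegrE// (le_trans q0 qb).
    move=> /le_trans; apply.
    have := Bs2 (adjoint B (B x)); have := Bs x x1.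
    move: (rnorm (B x) ^+ 2) (rnorm (B _) ^+ 2) (rnorm (adjoint _ _) ^+ 2)
      (sqr_ge0 (rnorm (B x))) (sqr_ge0 (rnorm (B (adjoint B (B x))))) ap' => u v w
        u0 v0 w0 h1 h2.
    apply: le_trans (ler_pM u0 v0 h1 h2) _.
    by rewrite le_eqVlt; apply/orP; left; apply/eqP; ring.
  have h2 : s * (e / (2 * s)) = e / 2 by field; rewrite gt_eqF.
  have := ler_wpM2l (ltW s0) (ltW xs); rewrite mulrBr h2 -/s expr2; lra.
have aW W : commutant W -> form_bounded a W.
  move=> Wc; have WBa y : W (adjoint B y) = adjoint B (W y).
    apply: rinner_inj => v; rewrite [LHS]radjE [LHS]radjEl [RHS]radjEl [RHS]radjE.
    by rewrite BW//; exact: commutant_adjoint.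
  apply: form_bounded_comm => x; rewrite /N/= /f.
  by rewrite [RHS]linearB [W (_ *: _)]linearZ/= WBa (BW _ Wc).
have [b [z [bd ab bz]]] := normal_localize ap ad aW.
(* Then |B^* B x| <= s / 2, so |N x| >= s / 2, against |N x|^2 <= s^2 / 8. *)
have [|r r0 rP] := B0 z (localize_spectrum bd bz) (s / (2 * M)).
  by rewrite divr_gt0// mulr_gt0.
have [|x [x1 bx xr]] := degenerate_approx bd bz (e := Num.min r (s ^+ 2 / 8)).
  by rewrite lt_min r0 divr_gt0// exprn_gt0.
have Bx : rnorm (B x) <= s / (2 * M).
  rewrite -[B x]subr0 -(scale0r x); apply: rP => // i.
  by apply: le_trans (xr i) _; rewrite ge_min lexx.
have : a x x <= s ^+ 2 / 8 by apply: le_trans (ab x) (le_trans bx _); rewrite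
  ge_min lexx orbT.
apply/negP; rewrite -ltNge /a rinnerE /N/= /f.
have hB : rnorm (adjoint B (B x)) <= s / 2.
  apply: le_trans (BaM _) _; rewrite -ler_pdivlMl//.
  by apply: le_trans Bx _; rewrite le_eqVlt; apply/orP; left; apply/eqP; field;
    rewrite gt_eqF.
have hs : s / 2 <= rnorm (s%:C *: x - adjoint B (B x)).
  have := rnormD (s%:C *: x - adjoint B (B x)) (adjoint B (B x)).
  by rewrite subrK rnormZr x1 mulr1 (gtr0_norm s0); lra.
apply: lt_le_trans (_ : (s / 2) ^+ 2 <= _).
  have : 0 < s ^+ 2 by rewrite exprn_gt0.
  have -> : (s / 2) ^+ 2 = s ^+ 2 / 4 by field.
  lra.
by rewrite ler_sqr ?nnegrE ?rnorm_ge0//; lra.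
Qed.

End NormalTuples.

(** * Theta-unitaries *)

Section GaussLucas.
Context {R : realType}.

Lemma prod_XsubC_expand d (w : 'rV[R[i]]_d) :
  \prod_j ('X - (w 0 j)%:P) =
  \sum_(A : {set 'I_d}) ((-1) ^+ #|A| * \prod_(j in A) w 0 j)%:P * 'X^(d - #|A|).
Proof.
under eq_bigr do rewrite addrC.
rewrite bigA_distr; apply: eq_bigr => A _.
rewrite (bigID (mem A))/=; congr (_ * _).
  under eq_bigr => j jA do rewrite jA -polyCN -mulN1r.
  rewrite -rmorph_prod big_split/= prodr_const; congr (_ * _)%:P.
under eq_bigr => j /negbTE jA do rewrite jA.
by rewrite prodr_const -[X in (X - _)%N]card_ord -(cardC (mem A)) addKn.
Qed.

Lemma coef_prod_elem_sym d (w : 'rV[R[i]]_d) i : (i <= d)%N ->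
  (\prod_j ('X - (w 0 j)%:P))`_(d - i) = (-1) ^+ i * elem_sym i w.
Proof.
move=> id; rewrite prod_XsubC_expand coef_sum /elem_sym mulr_sumr [RHS]big_mkcond/=.
apply: eq_bigr => A _; rewrite coefCM coefXn.
have Ad : (#|A| <= d)%N by rewrite -[X in (_ <= X)%N]card_ord max_card.
case: (eqVneq #|A| i) => [<-|Ai]; first by rewrite eqxx mulr1.
rewrite (_ : (_ == _) = false) ?mulr0//.
by apply/negbTE; move: Ad Ai; move: #|A| => c; lia.
Qed.

Lemma deriv_prod_XsubC (s : seq R[i]) v : v \notin s ->
  (\prod_(a <- s) ('X - a%:P))^`().[v] =
  (\prod_(a <- s) ('X - a%:P)).[v] * \sum_(a <- s) (v - a)^-1.
Proof.
elim: s => [|a s IH]; first by rewrite !big_nil derivC horner0 mulr0.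
rewrite inE negb_or => /andP[va vs]; rewrite !big_cons derivM derivXsubC !hornerE IH//.
by field; rewrite subr_eq0.
Qed.

(** The real part is (|v|^2 - Re (v conj w)) / |v - w|^2. *)
Lemma Re_ratio_gt0 (v w : R[i]) : 1 < cabs v -> cabs w <= 1 ->
  0 < complex.Re (v / (v - w)).
Proof.
move=> v1 w1.
have vw : v - w != 0.
  rewrite subr_eq0; apply: contraTneq v1 => ->; by rewrite -leNgt.
have {}v1 : 1 < complex.Re v ^+ 2 + complex.Im v ^+ 2.
  have : 1 < cabs v ^+ 2 by rewrite exprn_egt1// ltW.
  by rewrite /cabs normc_def/= sqr_sqrtr// addr_ge0// sqr_ge0.
have {}w1 : complex.Re w ^+ 2 + complex.Im w ^+ 2 <= 1.
  have : cabs w ^+ 2 <= 1 by rewrite exprn_ile1// cabs_ge0.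
  by rewrite /cabs normc_def/= sqr_sqrtr// addr_ge0// sqr_ge0.
case: v w vw v1 w1 => [a b] [c e]/= vw v1 w1.
have q0 : 0 < (a - c) ^+ 2 + (b - e) ^+ 2.
  rewrite lt_def addr_ge0 ?sqr_ge0// andbT; apply: contra vw.
  rewrite paddr_eq0 ?sqr_ge0// !sqrf_eq0 => /andP[/eqP h1 /eqP h2].
  by rewrite eq_complex/= h1 h2 eqxx.
have -> : a * ((a - c) / ((a - c) ^+ 2 + (b - e) ^+ 2)) -
    b * - ((b - e) / ((a - c) ^+ 2 + (b - e) ^+ 2)) =
    (a * (a - c) + b * (b - e)) / ((a - c) ^+ 2 + (b - e) ^+ 2).
  by field; rewrite gt_eqF.
rewrite divr_gt0//; have := sqr_ge0 (a - c); have := sqr_ge0 (b - e).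
rewrite !expr2 in v1 w1 *; lra.
Qed.

(* The v_j are the critical points of prod_j (X - w_j). *)
Lemma gauss_lucas k (w : 'rV[R[i]]_k.+1) : closed_polydisc R k.+1 w ->
  exists2 v, closed_polydisc R k v &
    forall i : 'I_k, elem_sym i.+1 v = gamma R i * elem_sym i.+1 w.
Proof.
move=> w1; pose P := \prod_j ('X - (w 0 j)%:P).
pose s := [seq w 0 j | j <- enum 'I_k.+1].
have PE : P = \prod_(a <- s) ('X - a%:P) by rewrite big_map big_enum.
have sP : size P = k.+2 by rewrite PE size_prod_XsubC size_map size_enum_ord.
have Pm : P \is monic by rewrite PE monic_prod_XsubC.
have k0 : k.+1%:R != 0 :> R[i] by rewrite pnatr_eq0.
have dPk : P^`()`_k = k.+1%:R.
  rewrite coef_deriv; have := monicP Pm; rewrite lead_coefE sP/= => ->.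
  by [].
have sdP : size P^`() = k.+1.
  apply/eqP; rewrite eqn_leq; apply/andP; split.
    by have := lt_size_deriv (p := P); rewrite -size_poly_eq0 sP; apply.
  by rewrite ltnNge; apply: contraNN k0 => /leq_sizeP/(_ k (leqnn _)); rewrite dPk
    => ->.
have [r rP] := closed_field_poly_normal P^`().
rewrite lead_coefE sdP/= dPk in rP.
have sr : size r = k.
  have := congr1 (fun p : {poly _} => size p) rP.
  by rewrite sdP size_scale// size_prod_XsubC => -[].
exists (\row_j r`_j) => [j|i].
  rewrite mxE; set v := r`_j.
  have vr : v \in r by rewrite mem_nth ?sr.
  have v0 : P^`().[v] = 0.
    by rewrite rP hornerZ (rootP (_ : root _ v)) ?mulr0// root_prod_XsubC.
  rewrite cabsE -[1]/(1%:C) lecR leNgt; apply/negP => v1.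
  have wv a : a \in s -> cabs a <= 1.
    by move=> /mapP[l _ ->]; have := w1 l; rewrite cabsE -[1]/(1%:C) lecR.
  have vs : v \notin s by apply/negP => /wv; rewrite leNgt v1.
  move: v0; rewrite PE deriv_prod_XsubC// => /eqP; rewrite mulf_eq0 => /orP[|/eqP S0].
    by rewrite -[_ == _]/(root _ _) root_prod_XsubC (negbTE vs).
  (* The factor v moves every term into the open right half-plane. *)
  have : complex.Re (v * \sum_(a <- s) (v - a)^-1) = 0 by rewrite S0 mulr0.
  rewrite mulr_sumr raddf_sum/=; apply/eqP; rewrite gt_eqF//.
  rewrite /s big_map big_enum/= (bigD1 ord0)//= ltr_wpDr//.
    by apply: sumr_ge0 => l _; rewrite ltW// Re_ratio_gt0// wv// map_f// mem_enum.
  by rewrite Re_ratio_gt0// wv// map_f// mem_enum.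
have ik := ltn_ord i.
(* This coefficient of P' is k - i times that of P in degree k.+1 - i.+1; division by the leading
   coefficient k.+1 of P' yields [gamma]. *)
have := congr1 (fun p : {poly _} => p`_(k - i.+1)) rP.
rewrite coef_deriv coefZ (_ : (k - i.+1).+1 = (k.+1 - i.+1)%N); last by lia.
rewrite coef_prod_elem_sym//; last by lia.
have -> : \prod_(z <- r) ('X - z%:P) = \prod_(j < k) ('X - ((\row_j r`_j : 'rV_k) 0
  j)%:P).
  by rewrite (big_nth 0) sr big_mkord; apply: eq_bigr => j _; rewrite mxE.
have s0 : (-1) ^+ i.+1 != 0 :> R[i] by rewrite signr_eq0.
rewrite coef_prod_elem_sym// -mulrnAr mulrCA => /(mulfI s0) h.
rewrite /gamma -[LHS](mulKf k0) -h subSS -[elem_sym _ _ *+ _]mulr_natl.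
by rewrite mulrA [_^-1 * _]mulrC.
Qed.

End GaussLucas.

Section ThetaUnitaries.
Context {R : realType}.

Lemma conj_torus (c : R[i]) : `|c| = 1 -> Num.conj c * c = 1.
Proof. by move=> c1; rewrite -normCKC c1 expr1n. Qed.

(** Conjugation inverts numbers of modulus 1, so the conjugate of the product over the complement of
    A cancels these factors in the full product. *)
Lemma elem_sym_torus d (v : 'rV[R[i]]_d) i : torus R d v -> (i <= d)%N ->
  elem_sym i v = Num.conj (elem_sym (d - i) v) * \prod_j v 0 j.
Proof.
move=> v1 id; rewrite /elem_sym rmorph_sum mulr_suml/=.
rewrite [RHS](reindex_inj (@finset.setC_inj _))/=.
apply: eq_big => [A|A _].
  have := cardsC A; rewrite card_ord; move: #|A| #|~: A|%SET => a b ab.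
  by apply/eqP/eqP; lia.
rewrite [X in _ = _ * X](bigID (mem A))/= rmorph_prod/= mulrCA.
under [X in _ = _ * (X * _)]eq_bigl => j do rewrite inE.
rewrite -big_split/= [X in _ = _ * X]big1 ?mulr1// => j _.
by rewrite conj_torus.
Qed.

Lemma theta_last m p k (w : 'rV[R[i]]_k.+1) :
  theta m p w 0 ord_max = (\prod_j w 0 j) ^+ (m %/ p).
Proof. by rewrite mxE eqxx. Qed.

Lemma theta_low m p k (w : 'rV[R[i]]_k.+1) (i : 'I_k) :
  theta m p w 0 (low i) = elem_sym i.+1 (\row_j w 0 j ^+ m).
Proof. by rewrite mxE /= eqSS ltn_eqF. Qed.

Lemma torus_exp m d (w : 'rV[R[i]]_d) : torus R d w -> torus R d (\row_j w 0 j ^+ m).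
Proof. by move=> w1 j; rewrite mxE normrX w1 expr1n. Qed.

Lemma bTheta_last m p k (z : 'rV[R[i]]_k.+1) : bTheta R m p k.+1 z ->
  Num.conj (z 0 ord_max) * z 0 ord_max = 1.
Proof.
move=> [w w1 <-]; rewrite theta_last conj_torus// normrX normr_prod big1 ?expr1n//.
Qed.

Lemma bTheta_low m p k (z : 'rV[R[i]]_k.+1) (i : 'I_k) : (p %| m)%N ->
  bTheta R m p k.+1 z ->
  z 0 (low i) = Num.conj (z 0 (low (rev_ord i))) * z 0 ord_max ^+ p.
Proof.
move=> pm [w w1 <-]; rewrite theta_last !theta_low -exprM divnK//.
have ik := ltn_ord i.
rewrite elem_sym_torus//; [|exact: torus_exp|by rewrite ltnW].
congr (Num.conj (elem_sym _ _) * _); first by rewrite /=; lia.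
by rewrite -prodrXl; apply: eq_bigr => j _; rewrite mxE.
Qed.

Lemma bTheta_Gamma m p k (z : 'rV[R[i]]_k.+1) : bTheta R m p k.+1 z ->
  Gamma R k (\row_i (gamma R i * z 0 (low i))).
Proof.
move=> [w w1 <-].
have [|v v1 vE] := @gauss_lucas R k (\row_j w 0 j ^+ m).
  by move=> j; rewrite torus_exp.
by exists v => //; apply/rowP => i; rewrite [LHS]mxE [RHS]mxE vE theta_low.
Qed.

Lemma bop_sub_exists (H K : hilbertType R) (S T : bounded_op H K) :
  exists B : bounded_op H K, forall x, B x = S x - T x.
Proof.
have [M M0 SM] := bop_bounded S; have [M' M'0 TM] := bop_bounded T.
apply: (@bop_exists _ _ _ _ (M + M')) => [a x y|x].
  by rewrite [S _]linearP [T _]linearP scalerBr opprD addrACA.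
by apply: le_trans (rnormB _ _) _; rewrite mulrDl lerD.
Qed.

(** * Operator relations in a Theta-unitary, and the spectrum of its scaled part *)

Section Relations.
Variables (L : hilbertType R) (m p k : nat) (U : 'I_k.+1 -> bounded_op L L).
Hypotheses (pm : (p %| m)%N) (Uu : Theta_unitary m p U).

Let Uc : commuting U. Proof. by case: Uu. Qed.
Let Un i : normal_op (U i). Proof. by case: Uu. Qed.
Let Us : joint_spectrum U `<=` bTheta R m p k.+1. Proof. by case: Uu. Qed.

Lemma commutant_exp W i q : commutant U W ->
  forall x, W (bop_exp (U i) q x) = bop_exp (U i) q (W x).
Proof. by move=> [WU _]; elim: q => //= q IH x; rewrite WU IH. Qed.

Lemma Theta_unitary_last x : adjoint (U ord_max) (U ord_max x) = x.
Proof.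
have [B BE] := bop_sub_exists (bop_comp (adjoint (U ord_max)) (U ord_max)) (bop_id L).
apply/subr0_eq; rewrite -[LHS]BE.
apply: (operator_vanish Uc Un) => [W [WU WUa] y|z /Us zT].
  by rewrite !BE/= linearB WUa WU.
have -> : (B : L -> L) = fun y => adjoint (U ord_max) (U ord_max y) - y.
  by apply/funext => y; rewrite BE.
rewrite -[0](subrr 1) -{1}(bTheta_last zT).
apply: symbolB; last exact: symbol_id.
apply: symbol_comp; last exact: symbol_coord.
exact: symbol_adjoint.
Qed.

Lemma Theta_unitary_low (i : 'I_k) x :
  U (low i) x = adjoint (U (low (rev_ord i))) (bop_exp (U ord_max) p x).
Proof.
have [B BE] := bop_sub_exists (U (low i))
  (bop_comp (adjoint (U (low (rev_ord i)))) (bop_exp (U ord_max) p)).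
apply/subr0_eq; rewrite -[LHS]BE.
apply: (operator_vanish Uc Un) => [W Wc y|z /Us zT].
  by have [WU WUa] := Wc; rewrite !BE/= linearB WUa WU commutant_exp.
have -> : (B : L -> L) = fun y => U (low i) y -
    adjoint (U (low (rev_ord i))) (bop_exp (U ord_max) p y).
  by apply/funext => y; rewrite BE.
rewrite -[0](subrr (z 0 (low i))) {2}(bTheta_low i pm zT).
apply: symbolB; first exact: symbol_coord.
apply: symbol_comp; first exact: symbol_adjoint.
exact: symbol_exp.
Qed.

Let V := gamma_scale (fun i => U (low i)).

Lemma gamma_scale_commuting : commuting V.
Proof.
move=> i j x; rewrite /V /gamma_scale /=.
by rewrite [U _ (_ *: _)]linearZ [U (low j) (_ *: _)]linearZ/= Uc !scalerA mulrC.
Qed.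

Lemma gamma_scale_adjoint i x :
  adjoint (V i) x = (gamma R i)^* *: adjoint (U (low i)) x.
Proof.
move: x; apply: adjoint_unique => x y.
by rewrite /V /gamma_scale /= rinnerZC radjE [adjoint _ (_ *: _)]linearZ.
Qed.

Lemma gamma_scale_normal i : normal_op (V i).
Proof.
move=> x; rewrite !gamma_scale_adjoint /V /gamma_scale /=.
by rewrite [adjoint _ (_ *: _)]linearZ [U _ (_ *: _)]linearZ/= Un !scalerA mulrC.
Qed.

(** V lacks U_n, without which bTheta says nothing. At a point l of the spectrum the form sum_i |V_i
    x - l_i x|^2 is degenerate; localizing it for the whole of U gives a point z of bTheta with
    approximate eigenvectors in common, whence l_i = gamma_i z_i. *)
Lemma gamma_scale_spectrum : joint_spectrum V `<=` Gamma R k.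
Proof.
move=> l lV.
have [N [NE NaE]] := shift_exists V (fun i => l 0 i).
have Vdc := fuglede_tuple gamma_scale_commuting gamma_scale_normal.
have Nc : commuting N.
  by move=> i j x; rewrite !NE; exact: shift_commute (gamma_scale_commuting i j) x.
have Ndc : doubly_commuting N.
  by move=> i j x; rewrite !NE !NaE; exact: shift_commute (Vdc i j) x.
pose a x y := \sum_i rinner (N i x) (N i y).
have ap : psd_form a.
  by apply: psd_sum => i; exact: psd_comp (@rinner_psd R L).
have aE x : a x x = \sum_i rnorm (N i x) ^+ 2.
  by apply: eq_bigr => i _; rewrite rinnerE.
have ad : degenerate a.
  move=> e e0; apply: contrapT => nx; apply: lV.
  apply: (koszul_exact_bounded_below NE Nc Ndc e0) => x.
  rewrite -aE; have [x0|x0] := eqVneq (rnorm x) 0.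
    by rewrite x0 expr0n mulr0 psd_ge0.
  have xp : 0 < rnorm x ^+ 2 by rewrite exprn_even_gt0.
  rewrite leNgt; apply/negP => xe; apply: nx.
  exists ((rnorm x)^-1%:C *: x); first exact: rnorm_normalize.
  rewrite psdZl// psdZr// mulrA -expr2 exprVn mulrC ler_pdivrMr//.
  exact: ltW.
have aW W : commutant U W -> form_bounded a W.
  move=> [WU _]; have [M M0 WM] := bop_bounded W; exists (M ^+ 2) => x.
  rewrite !aE mulr_sumr; apply: ler_sum => i _.
  have -> : N i (W x) = W (N i x).
    by rewrite !NE /V /gamma_scale /= linearB [W (_ *: _)]linearZ [W (_ *:
      x)]linearZ/= WU.
  by rewrite -exprMn ler_sqr ?nnegrE ?mulr_ge0 ?rnorm_ge0 ?(ltW M0).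
have [b [z [bd ab bz]]] := normal_localize Uc Un ap ad aW.
have /Us zT := localize_spectrum Un bd bz.
suff -> : l = \row_i (gamma R i * z 0 (low i)) by exact: bTheta_Gamma zT.
apply/rowP => i; rewrite mxE; apply/eqP; rewrite -subr_eq0 -normr_eq0 cabsE.
apply/eqP; congr (_%:C); apply/eqP; rewrite eq_le cabs_ge0 andbT.
apply/ler_addgt0Pr => e e0; rewrite add0r.
have g1 : 0 < 1 + cabs (gamma R i) by rewrite ltr_pwDl// cabs_ge0.
pose c := e / (1 + cabs (gamma R i)).
have c0 : 0 < c by rewrite divr_gt0.
have [|x [x1 bx xz]] := degenerate_approx bd bz (e := Num.min c (c ^+ 2)).
  by rewrite lt_min c0 exprn_gt0.
have xz1 : rnorm (U (low i) x - z 0 (low i) *: x) <= c.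
  by apply: le_trans (xz _) _; rewrite ge_min lexx.
have xN : rnorm (N i x) <= c.
  rewrite -ler_sqr ?nnegrE ?rnorm_ge0 ?(ltW c0)//.
  apply: le_trans (_ : b x x <= _); last by apply: le_trans bx _; rewrite ge_min
    lexx orbT.
  apply: le_trans (ab x); rewrite aE (bigD1 i)//= lerDl.
  by apply: sumr_ge0 => j _; rewrite sqr_ge0.
have -> : cabs (l 0 i - gamma R i * z 0 (low i)) =
    rnorm (gamma R i *: (U (low i) x - z 0 (low i) *: x) - N i x).
  rewrite NE /V /gamma_scale/= scalerBr scalerA opprB [X in rnorm X]addrC addrA
    subrK -scalerBl.
  by rewrite rnormZ x1 mulr1.
apply: le_trans (rnormB _ _) _; rewrite rnormZ.
have := ler_wpM2l (cabs_ge0 (gamma R i)) xz1.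
have : (1 + cabs (gamma R i)) * c = e by rewrite mulrC divfK// gt_eqF.
lra.
Qed.

End Relations.

End ThetaUnitaries.

(** * Isometric dilations *)

Section Coextension.
Context {R : realType} {H K : hilbertType R}.

Lemma isometric_rnorm (H' K' : hilbertType R) (J : bounded_op H' K') :
  isometric J -> forall x, rnorm (J x) = rnorm x.
Proof. by move=> Ji x; rewrite /rnorm Ji. Qed.

Lemma isometric_rinner (H' K' : hilbertType R) (J : H' -> K') :
  (forall x y, J (x + y) = J x + J y) -> (forall x, rnorm (J x) = rnorm x) ->
  forall x y, rinner (J x) (J y) = rinner x y.
Proof.
move=> JD Ji x y; have := Ji (x + y) => /(congr1 (fun t => t ^+ 2)).
rewrite JD !rnormD2 !Ji; lra.
Qed.

Lemma cs_rinnerE (G : hilbertType R) (V : closed_subspace G) (x y : cs_type V) :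
  rinner x y = rinner (val x) (val y).
Proof. by []. Qed.

Lemma cs_rnormE (G : hilbertType R) (V : closed_subspace G) (x : cs_type V) : rnorm
  x = rnorm (val x).
Proof. by []. Qed.

Lemma defect_dense_eq0 (D : bounded_op H H) (u : defect_space D) :
  (forall h, rinner u (corestrict D h) = 0) -> u = 0.
Proof.
move=> u0; apply: rnorm0_eq0; apply/eqP; rewrite eq_le rnorm_ge0 andbT.
apply/ler_addgt0Pr => e e0; rewrite add0r.
have [->|un0] := eqVneq (rnorm u) 0; first exact: ltW.
have up : 0 < rnorm u by rewrite lt_def un0 rnorm_ge0.
have /closureP/(_ e e0)[_ [h _ <-] hu] : closure (range D) (val u).
  by have := valP u; rewrite inE.
rewrite -(ler_pM2l up) -expr2 -rinnerE.
have -> : rinner u u = rinner u (u - corestrict D h) by rewrite rinnerBr u0 subr0.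
apply: le_trans (rinner_le1 _ _) _; rewrite ler_pM2l//.
by rewrite cs_rnormE (raddfB val) rnorm_distC ltW.
Qed.

Lemma defect_dense_op_eq (D : bounded_op H H)
    (A B : bounded_op (defect_space D) (defect_space D)) :
  (forall h h', rinner (A (corestrict D h)) (corestrict D h') =
                rinner (B (corestrict D h)) (corestrict D h')) -> A =1 B.
Proof.
move=> AB x; have [C CE] := bop_sub_exists A B.
apply/subr0_eq; rewrite -CE; apply: rinner_inj => y; rewrite rinner0l radjE.
suff -> : adjoint C y = 0 by rewrite rinner0r.
apply: defect_dense_eq0 => h; rewrite radjEl.
suff -> : C (corestrict D h) = 0 by rewrite rinner0r.
by apply: defect_dense_eq0 => h'; rewrite CE rinnerBl AB subrr.
Qed.

Variable J : bounded_op H K.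
Hypothesis Ji : isometric J.

Lemma adjoint_isometry x : adjoint J (J x) = x.
Proof.
apply: rinner_inj => y; rewrite radjEl; apply: isometric_rinner.
  exact: linearD.
exact: isometric_rnorm.
Qed.

Lemma ker_adjoint_closed : closed [set x | adjoint J x = 0].
Proof.
have [M M0 JM] := bop_bounded (adjoint J).
move=> x /closureP xc /=; apply: rnorm0_eq0; apply/eqP.
rewrite eq_le rnorm_ge0 andbT; apply/ler_addgt0Pr => e e0; rewrite add0r.
have [|y /= y0 yx] := xc (e / M); first by rewrite divr_gt0.
have -> : adjoint J x = - adjoint J (y - x) by rewrite linearB y0 sub0r opprK.
rewrite rnormN; apply: le_trans (JM _) _.
by rewrite mulrC -ler_pdivlMr// ltW.
Qed.

Lemma ker_adjoint_linear (a : R[i]) x y :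
  [set x | adjoint J x = 0] x -> [set x | adjoint J x = 0] y ->
  [set x | adjoint J x = 0] (a *: x + y).
Proof. by move=> /= x0 y0; rewrite linearP x0 y0 scaler0 addr0. Qed.

Definition ker_adjoint : closed_subspace K :=
  ClosedSubspace ker_adjoint_closed (linear0 (adjoint J)) ker_adjoint_linear.

Lemma ker_adjointP (y : cs_type ker_adjoint) : adjoint J (val y) = 0.
Proof. by have := valP y; rewrite inE. Qed.

Lemma coproj_subproof x : x - J (adjoint J x) \in cs_pred ker_adjoint.
Proof. by rewrite inE /= linearB adjoint_isometry subrr. Qed.

Definition coproj (x : K) : cs_type ker_adjoint := CsElt _ (coproj_subproof x).

Lemma coproj_linear (a : R[i]) x y : coproj (a *: x + y) = a *: coproj x + coproj y.
Proof.
apply: val_inj; rewrite (linearP val)/= [adjoint J _]linearP [J (_ + _)]linearP.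
by rewrite scalerBr opprD addrACA.
Qed.

Lemma rinner_ker_adjoint (y : K) h : adjoint J y = 0 -> rinner (J h) y = 0.
Proof. by move=> y0; rewrite radjE y0 rinner0r. Qed.

Lemma rinner_coproj x y : adjoint J y = 0 -> rinner (val (coproj x)) y = rinner x y.
Proof. by move=> y0 /=; rewrite rinnerBl rinner_ker_adjoint// subr0. Qed.

Lemma rnorm_coproj x :
  rnorm (coproj x) ^+ 2 = rnorm x ^+ 2 - rnorm (adjoint J x) ^+ 2.
Proof.
rewrite cs_rnormE /= rnormB2 isometric_rnorm// rinnerC radjE rinnerE; ring.
Qed.

(* |(1 - J J^* ) W J h|^2 = |W J h|^2 - |S h|^2 = |D h|^2. *)
Lemma defect_isometry (S D : bounded_op H H) (W : bounded_op K K) :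
  is_defect_op S D -> (forall x, rnorm (W x) = rnorm x) ->
  (forall x, adjoint J (W x) = S (adjoint J x)) ->
  exists Lam : bounded_op (defect_space D) (cs_type ker_adjoint),
    isometric Lam /\ forall h, Lam (corestrict D h) = coproj (W (J h)).
Proof.
move=> [D0 D2] Wi JW; apply: isometry_extend => [a x y|h].
  by rewrite [J _]linearP [W _]linearP coproj_linear.
apply/eqP; rewrite -(@eqrXn2 _ 2) ?rnorm_ge0//; apply/eqP.
rewrite rnorm_coproj Wi isometric_rnorm// JW adjoint_isometry -[RHS]rinnerE.
rewrite -(positive_selfadjoint D0) D2 rinnerBl radjEl !rinnerE.
by [].
Qed.

End Coextension.

(** * The four conditions for an isometric dilation *)

Section Dilation.
Context {R : realType} {H : hilbertType R} (m p k : nat).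
Variable T : 'I_k.+1 -> bounded_op H H.
Variables (Dp Dn : bounded_op H H).
Hypothesis hDp : is_defect_op (bop_exp (T ord_max) p) Dp.
Hypothesis hDn : is_defect_op (T ord_max) Dn.
Variable E : 'I_k -> bounded_op (defect_space Dp) (defect_space Dp).
Hypothesis hE : fundamental_operators (last_exp p T) E.

Variables (K : hilbertType R) (J : bounded_op H K) (V : 'I_k.+1 -> bounded_op K K).
Hypothesis Ji : isometric J.
Hypothesis JV : forall i h, adjoint (V i) (J h) = J (adjoint (T i) h).
Hypothesis Vc : commuting V.
Hypothesis Vi : forall x, rnorm (V ord_max x) = rnorm x.

Let W := bop_exp (V ord_max) p.
Let Tp := bop_exp (T ord_max) p.

Hypothesis VW : forall (i : 'I_k) x y,
  rinner (W x) (V (low (rev_ord i)) y) = rinner (V (low i) x) y.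

Lemma low_neq_max (i : 'I_k) : (low i == ord_max) = false.
Proof. by apply/negbTE; rewrite -val_eqE /= neq_ltn ltn_ord. Qed.

Lemma coextension i x : adjoint J (V i x) = T i (adjoint J x).
Proof. by apply: rinner_inj => y; rewrite radjEl radjE JV -radjEl [RHS]radjE. Qed.

Lemma coextension_exp x : adjoint J (W x) = Tp (adjoint J x).
Proof.
by rewrite /W /Tp; elim: p x => //= q IH x; rewrite coextension IH.
Qed.

Lemma exp_rnorm x : rnorm (W x) = rnorm x.
Proof. by rewrite /W; elim: p => //= q IH; rewrite Vi. Qed.

Lemma exp_comm i x : W (V i x) = V i (W x).
Proof. by rewrite /W; elim: p => //= q ->; rewrite Vc. Qed.

Lemma exp_rinner x y : rinner (W x) (W y) = rinner x y.
Proof. apply: isometric_rinner; [exact: linearD|exact: exp_rnorm]. Qed.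

Lemma VW_rev (i : 'I_k) x y :
  rinner (W x) (V (low i) y) = rinner (V (low (rev_ord i)) x) y.
Proof. by rewrite -VW rev_ordK. Qed.

(** The component of W' J h orthogonal to the range of J has norm |D h| = 0, so W' J h = J J^* W' J
    h. *)
Lemma defect_ker_rnorm (S D : bounded_op H H) (W' : bounded_op K K) h :
  is_defect_op S D -> (forall x, rnorm (W' x) = rnorm x) ->
  (forall x, adjoint J (W' x) = S (adjoint J x)) ->
  D h = 0 -> W' (J h) = J (S h).
Proof.
move=> SD W'i JW' Dh; have [Lam [Li LE]] := defect_isometry Ji SD W'i JW'.
have : coproj Ji (W' (J h)) = 0.
  apply: rnorm0_eq0; rewrite -LE isometric_rnorm// cs_rnormE/= Dh.
  exact: rnorm0.
move=> /(congr1 val)/= /subr0_eq ->.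
by rewrite JW' adjoint_isometry.
Qed.

Lemma ker_exp h : Dp h = 0 -> W (J h) = J (Tp h).
Proof. exact: defect_ker_rnorm hDp exp_rnorm coextension_exp. Qed.

Lemma ker_last h : Dn h = 0 -> V ord_max (J h) = J (T ord_max h).
Proof. exact: defect_ker_rnorm hDn Vi (coextension ord_max). Qed.

(** V_i J h = V_(n-i)^* J T_n^p h = J T_(n-i)^* T_n^p h lies in the range of J, and J^* then
    identifies it. *)
Lemma ker_low (i : 'I_k) h : Dp h = 0 -> V (low i) (J h) = J (T (low i) h).
Proof.
move=> /ker_exp Wh.
have VJ : V (low i) (J h) = J (adjoint (T (low (rev_ord i))) (Tp h)).
  apply: rinner_inj => y; rewrite -VW Wh radjE coextension [RHS]radjE.
  by rewrite radjEl.
rewrite VJ; congr (J _); have := coextension (low i) (J h).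
by rewrite VJ !adjoint_isometry.
Qed.

Let K' : hilbertType R := cs_type (ker_adjoint J).

Lemma restriction_subproof i (y : K') : V i (val y) \in cs_pred (ker_adjoint J).
Proof. by rewrite inE /= coextension ker_adjointP linear0. Qed.

Lemma restriction_exists : exists Tt : 'I_k -> bounded_op K' K',
  forall i y, val (Tt i y) = V (low i) (val y).
Proof.
have [|Tt TtE] := @choice _ _ (fun (i : 'I_k) (A : bounded_op K' K') =>
    forall y, val (A y) = V (low i) (val y)); last by exists Tt.
move=> i; have [M M0 VM] := bop_bounded (V (low i)).
have [||A AE] := @bop_exists _ K' K' (fun y => CsElt _ (restriction_subproof (low
  i) y)) M.
- move=> a x y; apply: val_inj; transitivity (V (low i) (val (a *: x + y))) => //.
  by rewrite [RHS](linearP val) (linearP val) [LHS]linearP.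
- by move=> x; rewrite !cs_rnormE/=; exact: VM.
by exists A => y; rewrite AE.
Qed.

Section Conclusions.
Variables (Lam : bounded_op (defect_space Dp) K') (Tt : 'I_k -> bounded_op K' K').
Hypothesis Li : isometric Lam.
Hypothesis LE : forall h, Lam (corestrict Dp h) = coproj Ji (W (J h)).
Hypothesis TtE : forall i y, val (Tt i y) = V (low i) (val y).

Lemma Tt_ker i y : adjoint J (V (low i) (val (y : K'))) = 0.
Proof. by rewrite -TtE ker_adjointP. Qed.

Lemma Lam_rinner x y : rinner (Lam x) (Lam y) = rinner x y.
Proof. apply: isometric_rinner; [exact: linearD|exact: isometric_rnorm]. Qed.

(** Paired with D h', the right side at D h is <Q W J h, V_(n-i) J h'>. Its two parts are <T_i h,
    h'> and <T_n^p h, T_(n-i) h'>, whose difference defines E_i. *)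
Lemma fundamental_compression i x : E i x = adjoint Lam (Tt i (Lam x)).
Proof.
move: x; apply: (defect_dense_op_eq (B := bop_comp (adjoint Lam) (bop_comp (Tt i)
  Lam))).
move=> h h' /=; rewrite radjEl !LE [RHS]cs_rinnerE TtE.
rewrite [RHS]rinnerC rinner_coproj ?Tt_ker// [RHS]rinnerC -[RHS]VW -exp_comm.
rewrite exp_rinner/= coextension_exp adjoint_isometry// [RHS]rinnerBl VW.
rewrite -(radjEl J) coextension adjoint_isometry// [X in _ - X]radjE coextension.
rewrite adjoint_isometry// [LHS]cs_rinnerE/= -(positive_selfadjoint hDp.1) -hE.
rewrite /last_exp eqxx !low_neq_max rinnerBl; congr (_ - _).
by rewrite radjEl.
Qed.

Lemma adjoint_E_rinner i u h : rinner (adjoint (E i) u) (corestrict Dp h) =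
  rinner (Lam u) (Tt i (Lam (corestrict Dp h))).
Proof. by rewrite radjEl fundamental_compression -radjE. Qed.

Lemma adjoint_E_rinner2 (i : 'I_k) v h : 
  rinner (adjoint (E i) (corestrict Dp v)) (corestrict Dp h) =
  rinner (V (low (rev_ord i)) (J v)) (val (Lam (corestrict Dp h))).
Proof.
rewrite adjoint_E_rinner LE cs_rinnerE TtE rinner_coproj ?Tt_ker//.
by rewrite VW_rev.
Qed.

(** Both terms pair with D h' as <V_i V_j J h, Lam D h'>. *)
Lemma condition2 (i j : 'I_k) h : Dp h = 0 ->
  adjoint (E (rev_ord i)) (corestrict Dp (T (low j) h)) -
  adjoint (E (rev_ord j)) (corestrict Dp (T (low i) h)) = 0.
Proof.
move=> Dh; apply: defect_dense_eq0 => h'.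
by rewrite rinnerBl !adjoint_E_rinner2 !rev_ordK -!ker_low// Vc subrr.
Qed.

(** V_(n-j) J T_n^p h = V_(n-j) W J h = W J T_(n-j) h, whose component in ker J^* is Lam D T_(n-j)
    h. This reduces condition (3) to condition (2). *)
Lemma adjoint_E_ker (j : 'I_k) h : Dp h = 0 ->
  adjoint (E j) (corestrict Dp (Tp h)) = corestrict Dp (T (low (rev_ord j)) h).
Proof.
move=> Dh; apply/subr0_eq/defect_dense_eq0 => h'.
rewrite rinnerBl adjoint_E_rinner2 -ker_exp// -exp_comm ker_low//.
rewrite -(Lam_rinner (corestrict Dp (T _ h))) [X in _ - X]cs_rinnerE.
rewrite [Lam (corestrict Dp (T _ h))]LE rinner_coproj ?subrr//.
exact: ker_adjointP.
Qed.

Lemma condition3 (i j : 'I_k) h : Dp h = 0 ->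
  let u := corestrict Dp (Tp h) in
  adjoint (E i) (adjoint (E j) u) - adjoint (E j) (adjoint (E i) u) = 0.
Proof.
move=> Dh u; rewrite /u !adjoint_E_ker//.
by have := condition2 (rev_ord i) (rev_ord j) Dh; rewrite !rev_ordK.
Qed.

(** Against y in ker J^* both terms become <V_i V_n J h, y>. *)
Lemma condition4 (Lams : bounded_op (defect_space Dn) K') (i : 'I_k) h :
  (forall g, Lams (corestrict Dn g) = coproj Ji (V ord_max (J g))) ->
  Dn h = 0 -> Dp h = 0 ->
  adjoint (Tt (rev_ord i)) (Lam (corestrict Dp (T ord_max h)))
    - Lams (corestrict Dn (T (low i) h)) = 0.
Proof.
move=> LsE Dnh Dph; apply: rinner_inj => y; rewrite rinner0l rinnerBl radjEl.
rewrite LE LsE !cs_rinnerE TtE !rinner_coproj ?Tt_ker ?ker_adjointP//.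
by rewrite VW -ker_last// -ker_low// Vc subrr.
Qed.

Lemma Tt_commuting : commuting Tt.
Proof. by move=> i j x; apply: val_inj; rewrite !TtE Vc. Qed.

End Conclusions.

End Dilation.

Theorem theorem5p5 (R : realType) (m p k : nat)
    (hm : (0 < m)%N) (hp : (0 < p)%N) (hpm : (p %| m)%N)
    (hn : (2 <= k.+1)%N)
    (H : hilbertType R) (T : 'I_k.+1 -> bounded_op H H)
    (hT : Theta_contraction m p T)
    (* Dp = D_(T_n^p) and Dn = D_(T_n) *)
    (Dp : bounded_op H H) (hDp : is_defect_op (bop_exp (T ord_max) p) Dp)
    (Dn : bounded_op H H) (hDn : is_defect_op (T ord_max) Dn)
    (E : 'I_k -> bounded_op (defect_space Dp) (defect_space Dp))
    (hE : fundamental_operators (last_exp p T) E)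
    (hdil : has_Theta_isometric_dilation m p T) :
  [/\ (exists (K : hilbertType R) (Lam : bounded_op (defect_space Dp) K)
              (Tt : 'I_k -> bounded_op K K),
          subnormal_dilation E Lam Tt),
      (forall (i j : 'I_k) (h : H), Dp h = 0 ->
          adjoint (E (rev_ord i)) (corestrict Dp (T (low j) h))
          - adjoint (E (rev_ord j)) (corestrict Dp (T (low i) h)) = 0),
      (forall (i j : 'I_k) (h : H), Dp h = 0 ->
          let u := corestrict Dp (bop_exp (T ord_max) p h) in
          adjoint (E i) (adjoint (E j) u) - adjoint (E j) (adjoint (E i) u) = 0)
    & (exists (K : hilbertType R) (Lam : bounded_op (defect_space Dp) K)
              (Tt : 'I_k -> bounded_op K K),
          subnormal_dilation E Lam Tt /\
          exists Lams : bounded_op (defect_space Dn) K,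
            isometric Lams /\
            forall (i : 'I_k) (h : H), Dn h = 0 -> Dp h = 0 ->
              adjoint (Tt (rev_ord i)) (Lam (corestrict Dp (T ord_max h)))
              - Lams (corestrict Dn (T (low i) h)) = 0) ].
Proof.
case: hdil => K [J [V [Ji [L [J' [U [Uu [J'i UV]]]]] JV]]].
have J'n := isometric_rnorm J'i.
have J'r : forall x y, rinner (J' x) (J' y) = rinner x y.
  by apply: isometric_rinner => //; exact: linearD.
have J'_inj x y : J' x = J' y -> x = y.
  move=> xy; apply/subr0_eq/rnorm0_eq0.
  by rewrite -J'n linearB xy subrr rnorm0.
have UVp q x : bop_exp (U ord_max) q (J' x) = J' (bop_exp (V ord_max) q x).
  by elim: q => //= q ->; rewrite UV.
have Uc : commuting U by case: Uu.
have Vc : commuting V by move=> i j x; apply: J'_inj; rewrite -!UV Uc.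
have Vi x : rnorm (V ord_max x) = rnorm x.
  apply/eqP; rewrite -(@eqrXn2 _ 2) ?rnorm_ge0// -!J'n -UV -!rinnerE -radjEl.
  by rewrite (Theta_unitary_last Uu).
have VW (i : 'I_k) x y : rinner (bop_exp (V ord_max) p x) (V (low (rev_ord i)) y) =
    rinner (V (low i) x) y.
  by rewrite -!J'r -!UV -UVp (Theta_unitary_low hpm Uu i) radjEl.
have [Lam [Li LE]] := defect_isometry Ji hDp (exp_rnorm p Vi) (coextension_exp p JV).
have [Lams [Lsi LsE]] := defect_isometry Ji hDn Vi (coextension JV ord_max).
have [Tt TtE] := restriction_exists JV.
have EE := fundamental_compression hDp hE JV Vc Vi VW LE TtE.
have sub : subnormal_dilation E Lam Tt.
  split=> //; first exact (Tt_commuting Vc TtE).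
  (* ker J^* sits in K, and K in L through J'; the normal extension of the restrictions of V_i is
     therefore U_i itself. *)
  have [||I IE] := @bop_exists _ (cs_type (ker_adjoint J)) L (fun y => J' (val y)) 1.
  - by move=> a x y; rewrite (linearP val) linearP.
  - by move=> y; rewrite mul1r J'n.
  exists L, I, (fun i => U (low i)); split.
  - exact: gamma_scale_commuting Uu.
  - exact: gamma_scale_normal Uu.
  - exact: gamma_scale_spectrum Uu.
  - split=> [y|i y]; first by rewrite !normE IE J'n.
    rewrite /gamma_scale/= !IE UV -TtE.
    have -> : val (gamma R i *: Tt i y) = gamma R i *: val (Tt i y) by [].
    by rewrite [J' (_ *: _)]linearZ.
split.
- by exists (cs_type (ker_adjoint J)), Lam, Tt.
- move=> i j h Dh.
  exact (condition2 hDp hE JV Vc Vi VW LE TtE i j Dh).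
- move=> i j h Dh.
  exact (condition3 hDp hE JV Vc Vi VW Li LE TtE i j Dh).
- exists (cs_type (ker_adjoint J)), Lam, Tt; split=> //; exists Lams; split=> //.
  move=> i h Dnh Dph.
  exact (condition4 hDp hDn JV Vc Vi VW LE TtE i LsE Dnh Dph).
Qed.
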